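(* The set of all minimal subshifts conjugate to a rank-$1$ subshift is not generic in any of $\mathcal{S}'_2$, $\overline{\mathcal{T}'_2}$, $\overline{\mathcal{TT}'_2}$. Moreover, it is not $G_\delta$ in either $\overline{\mathcal{T}'_2}$ or $\overline{\mathcal{TT}'_2}$. (In each space $\mathcal{X}$ the set meant is that of all $X\in\mathcal{X}$ such that $(X,\sigma)$ is minimal and conjugate to a rank-$1$ subshift.)
   Context: $2^{\mathbb{Z}}=\{0,1\}^{\mathbb{Z}}$ has the product topology, $\sigma(x)(n)=x(n+1)$. $\mathcal{S}_2$ is the space of all subshifts, i.e. closed $X\subseteq2^{\mathbb{Z}}$ with $\sigma X=X$, with the Hausdorff metric; an equivalent metric is $d_L(X,Y)=2^{-\inf\{n:L_n(X)\ne L_n(Y)\}}$, where $L_n(X)$ is the set of words of length $n$ occurring in some element of $X$. $\mathcal{S}_2$ is Polish. $\mathcal{S}'_2$ is the (Polish) subspace of all elements of $\mathcal{S}_2$ that are not isolated points of $\mathcal{S}_2$. A system $(X,T)$ is transitive if some orbit $\{T^kx:k\in\mathbb{Z}\}$ is dense, and totally transitive if for every integer $n\ge1$ there is $x\in X$ with $\{T^{nk}x:k\in\mathbb{Z}\}$ dense in $X$. $\mathcal{T}'_2$ (resp. $\mathcal{TT}'_2$) is the subspace of transitive (resp. totally transitive) subshifts in $\mathcal{S}'_2$, and $\overline{\mathcal{T}'_2}$, $\overline{\mathcal{TT}'_2}$ are their closures in $\mathcal{S}'_2$. A subset of a Polish space is generic if it contains a dense $G_\delta$ subset. A subshift is minimal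 if all orbits are dense. Systems $(X,T)$ and $(Y,S)$ are conjugate if there is a homeomorphism $\varphi:X\to Y$ with $\varphi T=S\varphi$. Rank-$1$ subshifts: Given integers $r_n>1$ ($n\ge0$) and nonnegative integers $s_{n,i}$ ($n\ge0$, $1\le i<r_n$), define $v_0=0$ and $v_{n+1}=v_n1^{s_{n,1}}v_n\cdots v_n1^{s_{n,r_n-1}}v_n$ (with $r_n$ copies of $v_n$). The infinite word $V=\lim_nv_n$ is a rank-$1$ word, and $X_V=\{x\in2^{\mathbb{Z}}:$ every finite subword of $x$ is a subword of $V\}$ is a rank-$1$ subshift. *)

(* Defs.v *)
From HB Require Import structures.
From mathcomp Require Import all_boot all_order all_algebra.
From mathcomp Require Import all_classical all_reals all_analysis.
From mathcomp Require Import borel_hierarchy.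

Set Implicit Arguments.
Unset Strict Implicit.
Unset Printing Implicit Defensive.

Import Order.TTheory GRing.Theory Num.Theory.

Local Open Scope classical_set_scope.
Local Open Scope ring_scope.

Definition fullshift : Type := prod_topology (fun _ : int => bool).

HB.instance Definition _ := Pointed.on fullshift.
HB.instance Definition _ := Uniform.on fullshift.
HB.instance Definition _ (R : realType) :=
  PseudoMetric.copy fullshift (prod_topology (fun _ : int => (bool : pseudoMetricType R))).

(* The [k]-th power of the shift map. *)
Definition shiftz (k : int) (x : fullshift) : fullshift := fun n => x (n + k).

Definition shift : fullshift -> fullshift := shiftz 1.

Definition subshift : Type :=
  [set X : set fullshift | closed X /\ shift @` X = X].

HB.instance Definition _ := Choice.on subshift.

(** ** The Hausdorff metric *)

Definition hausdorff_rel {T : Type} (E : set (T * T)) (A B : set T) : Prop :=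
  (forall x, A x -> exists2 y, B y & E (x, y)) /\
  (forall y, B y -> exists2 x, A x & E (x, y)).

Lemma hausdorff_rel_sub {T : Type} (E F : set (T * T)) (A B : set T) :
  E `<=` F -> hausdorff_rel E A B -> hausdorff_rel F A B.
Proof.
move=> EF [H1 H2]; split=> x Ax.
- by have [y By Exy] := H1 x Ax; exists y => //; exact: EF.
- by have [y By Exy] := H2 x Ax; exists y => //; exact: EF.
Qed.

Definition hausdorff_ent (E : set (fullshift * fullshift)) :
    set (subshift * subshift) :=
  [set XY | hausdorff_rel E (set_val XY.1) (set_val XY.2)].

Definition subshift_entourage : set_system (subshift * subshift) :=
  filter_from entourage hausdorff_ent.

Local Open Scope relation_scope.

Lemma subshift_entourage_filter : Filter subshift_entourage.
Proof.
apply: filter_from_filter; first by exists setT; exact: filterT.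
move=> E F entE entF; exists (E `&` F); first exact: filterI.
by move=> XY H; split; apply: hausdorff_rel_sub H => ? [].
Qed.

Lemma subshift_entourage_diagonal A : subshift_entourage A -> diagonal `<=` A.
Proof.
move=> [E entE EA] [X Y]; rewrite /diagonal /= => <-; apply: EA.
by split=> x Xx; exists x => //; exact: entourage_refl.
Qed.

Lemma subshift_entourage_inv A : subshift_entourage A -> subshift_entourage A^-1.
Proof.
move=> [E entE EA]; exists E^-1; first exact: entourage_inv.
by move=> [X Y] [H1 H2]; apply: EA; split.
Qed.

Lemma subshift_entourage_split A : subshift_entourage A ->
  exists2 B, subshift_entourage B & B \; B `<=` A.
Proof.
move=> [E entE EA]; exists (hausdorff_ent (split_ent E)).
  by exists (split_ent E) => //; exact: entourage_split_ent.
move=> [X Z] [Y /= [XY YX] [YZ ZY]]; apply: EA; split=> [x|z] /=.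
- move=> /XY[y /YZ[z Zz yz] xy]; exists z => //.
  by apply: (subset_split_ent entE); exists y.
- move=> /ZY[y /YX[x Xx xy] yz]; exists x => //.
  by apply: (subset_split_ent entE); exists y.
Qed.

HB.instance Definition _ := isUniform.Build subshift
  subshift_entourage_filter subshift_entourage_diagonal
  subshift_entourage_inv subshift_entourage_split.

(* The uniformity above is that of the Hausdorff metric: the ball of radius [e]
   around [X] is the set of the [Y] such that each of [X] and [Y] lies in the
   [e]-neighbourhood of the other. The empty subshift is at infinite distance
   from all the others, hence isolated. *)
Section hausdorff_metric.
Context {R : realType}.

Definition hausdorff_ball (X : subshift) (e : R) (Y : subshift) : Prop :=
  hausdorff_rel [set xy : fullshift * fullshift | ball xy.1 e xy.2]
    (set_val X) (set_val Y).

Lemma hausdorff_ball_center X (e : R) : 0 < e -> hausdorff_ball X e X.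
Proof. by move=> e0; split=> x Xx; exists x => //; exact: ballxx. Qed.

Lemma hausdorff_ball_sym X Y (e : R) :
  hausdorff_ball X e Y -> hausdorff_ball Y e X.
Proof.
move=> [XY YX]; split=> x.
- by move=> /YX[y ? ?]; exists y => //; exact: ball_sym.
- by move=> /XY[y ? ?]; exists y => //; exact: ball_sym.
Qed.

Lemma hausdorff_ball_triangle X Y Z (e1 e2 : R) :
  hausdorff_ball X e1 Y -> hausdorff_ball Y e2 Z -> hausdorff_ball X (e1 + e2) Z.
Proof.
move=> [XY YX] [YZ ZY]; split=> [x|z].
- move=> /XY[y /YZ[z Zz yz] xy]; exists z => //; exact: ball_triangle xy yz.
- move=> /ZY[y /YX[x Xx xy] yz]; exists x => //; exact: ball_triangle xy yz.
Qed.

Lemma hausdorff_entourageE :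
  entourage = entourage_ hausdorff_ball :> set_system (subshift * subshift).
Proof.
rewrite eqEsubset; split=> A.
- move=> [E]; rewrite -(@entourage_ballE R) => -[e e0 eE] EA.
  by exists e => // XY H; apply: EA; exact: hausdorff_rel_sub eE H.
- move=> [e e0 eA].
  exists [set xy : fullshift * fullshift | ball xy.1 e xy.2] => //.
  by rewrite -(@entourage_ballE R); exists e.
Qed.

End hausdorff_metric.

HB.instance Definition _ (R : realType) := Uniform_isPseudoMetric.Build R subshift
  (@hausdorff_ball_center R) (@hausdorff_ball_sym R)
  (@hausdorff_ball_triangle R) (@hausdorff_entourageE R).

(** ** Dynamics *)

(* The orbit of [x] under the [p]-th power of the shift. *)
Definition shift_orbit (p : nat) (x : fullshift) : set fullshift :=
  range (fun k : int => shiftz (p%:Z * k) x).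

Definition topologically_transitive (X : set fullshift) : Prop :=
  exists2 x, X x & X `<=` closure (shift_orbit 1 x).

Definition totally_transitive (X : set fullshift) : Prop :=
  forall p : nat, (0 < p)%N -> exists2 x, X x & X `<=` closure (shift_orbit p x).

Definition minimal (X : set fullshift) : Prop :=
  forall x, X x -> X `<=` closure (shift_orbit 1 x).

(* The conjugacy [f : X -> Y] and its inverse [g : Y -> X] are represented by
   functions on the full shift, of which only the restrictions matter. *)
Definition conjugate (X Y : set fullshift) : Prop :=
  exists f g : fullshift -> fullshift,
    [/\ set_fun X Y f /\ set_fun Y X g,
        {in X, cancel f g} /\ {in Y, cancel g f},
        {within X, continuous f} /\ {within Y, continuous g} &
        {in X, forall x, f (shift x) = shift (f x)}].

(** ** Rank-1 subshifts *)

(* [false] and [true] are the letters 0 and 1, [r n] is the number of copies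
   of [v_n] in [v_{n+1}], and [s n i] is the [i]-th spacer, 1 <= i < r n. *)
Fixpoint rank1_block (r : nat -> nat) (s : nat -> nat -> nat) (n : nat) :
    seq bool :=
  if n is m.+1 then
    let v := rank1_block r s m in
    flatten [seq v ++ nseq (s m i) true | i <- iota 1 (r m).-1] ++ v
  else [:: false].

(* [V] is the limit of its prefixes [v_n], whose lengths tend to infinity
   because [r n > 1]. *)
Definition rank1_word (V : nat -> bool) : Prop :=
  exists (r : nat -> nat) (s : nat -> nat -> nat),
    (forall n, (1 < r n)%N) /\
    (forall n, mkseq V (size (rank1_block r s n)) = rank1_block r s n).

Definition word_closure (V : nat -> bool) : set fullshift :=
  [set x | forall (i : int) (n : nat), exists j : nat,
     mkseq (fun k => x (i + k%:Z)) n = mkseq (fun k => V (j + k)%N) n].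

Definition minimal_rank1 : set subshift :=
  [set X | minimal (set_val X) /\
    exists2 V, rank1_word V & conjugate (set_val X) (word_closure V)].

(** ** The spaces *)

Definition S2' : set subshift := ~` isolated [set: subshift].

Definition T2' : set S2' := [set X | topologically_transitive (set_val (set_val X))].

Definition TT2' : set S2' := [set X | totally_transitive (set_val (set_val X))].

Definition generic {T : topologicalType} (A : set T) : Prop :=
  exists G : set T, [/\ dense G, Gdelta G & G `<=` A].

(* Main.v *)
(** A minimal subshift that is conjugate to a rank-1 subshift has bounded
    spacers, so for some constant [C] it is, at arbitrarily large scales, a
    concatenation of copies of one word [W] separated by gaps of length at most
    [C], two of which have different lengths (otherwise it would be periodic,
    hence isolated). The subshifts for which, at some scale, the two words
    around a gap of length at most [C] determine the length of the gap form an
    open set; by the Baire argument it is enough to see that in the closure of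
    the totally transitive subshifts this set is dense, for every [C].

    Given a totally transitive nonisolated [X], the words of [X] that return to a
    right special word [u] ("loops") have all large lengths. From them one builds
    two blocks [A] and [B] with [|B| = |A| + D], [C < D], whose concatenations
    look locally like [X] and whose boundaries are recognized by a long periodic
    run. Concatenating [A] and [B] along the Chacon sequence gives a minimal
    totally transitive subshift which is conjugate to a rank-1 subshift with
    spacers [0] and [D], and for which gaps of length at most [C] are determined.
    So the rank-1 class is dense too, and it cannot be a G-delta set.

    In the first two spaces genericity already fails because some nonisolated
    transitive subshift has a neighbourhood without minimal subshifts: all its
    neighbours contain the fixed point [000...] and the letter [1]. *)

From HB Require Import structures.
Require Import Defs.
From mathcomp Require Import all_boot all_order all_algebra.
From mathcomp Require Import all_classical all_reals all_analysis.
From mathcomp Require Import borel_hierarchy.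
From mathcomp Require Import finmap zify.

Set Implicit Arguments.
Unset Strict Implicit.
Unset Printing Implicit Defensive.

Import Order.TTheory GRing.Theory Num.Theory.

(** * Concatenations of two blocks *)

Lemma size_flatten_nseq (T : Type) k (l : seq T) : size (flatten (nseq k l)) = (k * size l).
Proof. by rewrite size_flatten /shape map_nseq sumn_nseq mulnC. Qed.

Lemma nth_flatten_nseq (P : seq bool) q k : (k < q * size P) ->
  nth false (flatten (nseq q P)) k = nth false P (k %% size P).
Proof.
elim: q k => [//|q IH] k /= kq; rewrite nth_cat; case: ltnP => kP.
  by rewrite modn_small.
by rewrite IH; [rewrite -{2}(subnK kP) modnDr|lia].
Qed.

Definition occurs (V : nat -> bool) (w : seq bool) (i : nat) : Prop :=
  forall k, k < size w -> V (i + k) = nth false w k.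

Definition cutpos (blk : bool -> seq bool) (z : nat -> bool) (n : nat) : nat :=
  \sum_(i < n) size (blk (z i)).

(** When blocks are nonempty, the first [i.+1] of them already cover position [i], so the default
    letter is never read. *)
Definition conc (blk : bool -> seq bool) (z : nat -> bool) (i : nat) : bool :=
  nth false (flatten [seq blk (z j) | j <- iota 0 i.+1]) i.

Definition is_cut blk z i := exists n, i = cutpos blk z n.

Section Concatenation.
Variables (blk : bool -> seq bool) (z : nat -> bool).
Hypothesis blk_gt0 : forall x, 0 < size (blk x).
Local Notation pos := (cutpos blk z).
Local Notation V := (conc blk z).

Lemma cutpos0 : pos 0 = 0. Proof. by rewrite /cutpos big_ord0. Qed.

Lemma cutposS n : pos n.+1 = pos n + size (blk (z n)).
Proof. by rewrite /cutpos big_ord_recr. Qed.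

Lemma cutpos_size n : pos n = size (flatten [seq blk (z j) | j <- iota 0 n]).
Proof.
elim: n => [|n IH]; first by rewrite cutpos0.
by rewrite cutposS IH -addn1 iotaD map_cat flatten_cat size_cat /= cats0 add0n.
Qed.

Lemma leq_cutpos n : n <= pos n.
Proof. by elim: n => [//|n IH]; rewrite cutposS; have := blk_gt0 (z n); lia. Qed.

Lemma leq_cutpos2 m n : m <= n -> pos m <= pos n.
Proof.
move=> /subnKC <-; elim: (n - m) => [|k IH]; first by rewrite addn0.
by rewrite addnS cutposS; lia.
Qed.

Lemma ltn_cutpos m n : m < n -> pos m + size (blk (z m)) <= pos n.
Proof. by move=> mn; rewrite -cutposS leq_cutpos2. Qed.

Lemma locate i : exists n k, i = pos n + k /\ k < size (blk (z n)).
Proof.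
elim: i => [|i [n [k [-> kn]]]]; first by exists 0, 0; rewrite cutpos0.
have [kn1|kn1] := ltnP k.+1 (size (blk (z n))).
  by exists n, k.+1; rewrite addnS.
exists n.+1, 0; split; last exact: blk_gt0.
by rewrite cutposS; lia.
Qed.

Lemma locate_inj m n k l : k < size (blk (z m)) -> l < size (blk (z n)) ->
  pos m + k = pos n + l -> m = n /\ k = l.
Proof.
move=> km ln e; have [mn|nm|mn] := ltngtP m n.
- by have := ltn_cutpos mn; lia.
- by have := ltn_cutpos nm; lia.
- by subst n; lia.
Qed.

Lemma concE n k : k < size (blk (z n)) -> V (pos n + k) = nth false (blk (z n)) k.
Proof.
move=> kn; rewrite /conc.
have -> : (pos n + k).+1 = n + (1 + (pos n + k - n)).
  by have := leq_cutpos n; lia.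
rewrite iotaD map_cat flatten_cat nth_cat -cutpos_size ifN; last by lia.
by rewrite addKn add0n /= nth_cat kn.
Qed.

Lemma conc_uniq (W : nat -> bool) :
  (forall n k, k < size (blk (z n)) -> W (pos n + k) = nth false (blk (z n)) k) ->
  W =1 V.
Proof. by move=> H i; have [n [k [-> kn]]] := locate i; rewrite H // concE. Qed.

Lemma next_cut (b : nat) i : (forall x, size (blk x) <= b) ->
  exists n, i <= pos n < i + b.
Proof.
move=> bb; have [n [k [-> kn]]] := locate i; have := bb (z n); case: k kn => [|k] kn ?.
  by exists n; lia.
by exists n.+1; rewrite cutposS; lia.
Qed.

Lemma cutposD (alpha D m n : nat) : (forall x, size (blk x) = alpha + x * D) ->
  exists2 j, j <= m & pos (n + m) = pos n + m * alpha + j * D.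
Proof.
move=> sz; elim: m => [|m [j jm IH]]; first by exists 0; rewrite ?addn0.
exists (j + z (n + m)); first by case: (z _); lia.
by rewrite addnS cutposS IH sz; lia.
Qed.

End Concatenation.

Lemma cutpos_ext blk blk' z n : (forall x, size (blk x) = size (blk' x)) ->
  cutpos blk z n = cutpos blk' z n.
Proof. by move=> e; apply: eq_bigr => i _; rewrite e. Qed.

(** * Windows, recognizability and block factors *)

Definition agree (V : nat -> bool) (rho i j : nat) : Prop :=
  forall t, t <= rho.*2 -> V (i - rho + t) = V (j - rho + t).

Lemma agree_sub V rho rho' i j k : agree V rho i j -> rho <= i -> rho <= j ->
  rho' + k <= rho -> agree V rho' (i - k) (j - k).
Proof.
move=> ag ri rj rr t tr; have := ag (rho - rho' - k + t).
have -> : i - rho + (rho - rho' - k + t) = i - k - rho' + t by lia.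
have -> : j - rho + (rho - rho' - k + t) = j - k - rho' + t by lia.
by apply; lia.
Qed.

Lemma agree_subr V rho rho' i j k : agree V rho i j -> rho <= i -> rho <= j ->
  rho' + k <= rho -> agree V rho' (i + k) (j + k).
Proof.
move=> ag ri rj rr t tr; have := ag (rho - rho' + k + t).
have -> : i - rho + (rho - rho' + k + t) = i + k - rho' + t by lia.
have -> : j - rho + (rho - rho' + k + t) = j + k - rho' + t by lia.
by apply; lia.
Qed.

Lemma agree_sym V rho i j : agree V rho i j -> agree V rho j i.
Proof. by move=> ag t /ag. Qed.

(** The one-sided form of a sliding block code of radius [rho]; [block_code] turns it into a map
    between the two-sided closures. *)
Definition block_factor (rho : nat) (V W : nat -> bool) : Prop :=
  forall i j, rho <= i -> rho <= j -> agree V rho i j -> W i = W j.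

Definition recognizable rho blk z : Prop := forall i j, rho <= i -> rho <= j ->
  agree (conc blk z) rho i j -> is_cut blk z i -> is_cut blk z j.

(** Recognized cuts give the length of the block around a position and the offset inside it. The two
    lengths differ, so the length gives the letter of [z], hence the block of [blk']. *)
Lemma recognizable_factor rho blk blk' z :
  (forall x, size (blk x) = size (blk' x)) ->
  0 < size (blk false) < size (blk true) ->
  recognizable rho blk z ->
  block_factor (rho + size (blk true)) (conc blk z) (conc blk' z).
Proof.
move=> esz /andP[s0 s1] rec.
have blk_gt0 x : 0 < size (blk x) by case: x; lia.
have blk_le x : size (blk x) <= size (blk true) by case: x; lia.
have blk'_gt0 x : 0 < size (blk' x) by rewrite -esz.
set beta := size (blk true) in blk_le *.
move=> i j ri rj ag.
have [n [k [ei kn]]] := locate z blk_gt0 i.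
have kb := blk_le (z n).
(* The extra [size (blk true)] in the radius keeps both ends of the block in view. *)
have cut0 : is_cut blk z (j - k).
  apply: (rec (i - k)); try lia; first by apply: agree_sub ag _ _ _; lia.
  by exists n; lia.
have [m em] := cut0.
have cut1 : is_cut blk z (j - k + size (blk (z n))).
  rewrite (_ : _ + _ = j + (size (blk (z n)) - k)); last by lia.
  apply: (rec (i + (size (blk (z n)) - k))); try lia.
    by apply: agree_subr ag _ _ _; lia.
  by exists n.+1; rewrite cutposS; lia.
(* Agreement is symmetric, so a cut strictly inside the copy near [j] would give one strictly inside
   the block around [i]. *)
have nocut t : 0 < t < size (blk (z n)) -> ~ is_cut blk z (j - k + t).
  move=> /andP[t0 tn] ct.
  have [l el] : is_cut blk z (i - k + t).
    have [kt|tk] := leqP k t.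
      rewrite (_ : i - k + t = i + (t - k)); last by lia.
      apply: (rec (j + (t - k))); try lia.
        by apply: agree_subr (agree_sym ag) _ _ _; lia.
      by rewrite (_ : j + (t - k) = j - k + t) //; lia.
    rewrite (_ : i - k + t = i - (k - t)); last by lia.
    apply: (rec (j - (k - t))); try lia.
      by apply: agree_sub (agree_sym ag) _ _ _; lia.
    by rewrite (_ : j - (k - t) = j - k + t) //; lia.
  have := @locate_inj blk z l n 0 t.
  by rewrite addn0 => /(_ (blk_gt0 _) tn) -[]; lia.
have zmn : z m = z n.
  have szmn : size (blk (z m)) = size (blk (z n)).
    have [lt|gt|//] := ltngtP (size (blk (z m))) (size (blk (z n))).
      exfalso; apply: (nocut (size (blk (z m)))); first by rewrite blk_gt0.
      by exists m.+1; rewrite cutposS; lia.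
    have [l el] := cut1.
    have := @locate_inj blk z l m 0 (size (blk (z n))).
    by rewrite addn0 => /(_ (blk_gt0 _) gt) -[]; have := blk_gt0 (z n); lia.
  by move: szmn; rewrite /beta; case: (z m); case: (z n) => //; lia.
have ej : j = cutpos blk' z m + k by rewrite -(cutpos_ext z m esz); lia.
have ei' : i = cutpos blk' z n + k by rewrite -(cutpos_ext z n esz).
by rewrite ej ei' !concE ?zmn // -esz.
Qed.

(** The bound [4 * alpha] leaves at most three blocks. Then [4 * D + C < alpha] separates different
    numbers of blocks and [C < D] separates different numbers of long ones. *)
Lemma block_sum_inj alpha D C a b a' b' : C < D -> 4 * D + C < alpha ->
  b <= a -> b' <= a' ->
  a * alpha + b * D < 4 * alpha -> a' * alpha + b' * D < 4 * alpha ->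
  a * alpha + b * D <= a' * alpha + b' * D + C ->
  a' * alpha + b' * D <= a * alpha + b * D + C -> a = a' /\ b = b'.
Proof.
have small x y : y <= x -> x * alpha + y * D < 4 * alpha -> x <= 3.
  by move=> _ h; rewrite leqNgt; apply/negP => /(leq_mul (leqnn alpha)); lia.
move=> CD Da ba ba' s s'; have := small _ _ ba s; have := small _ _ ba' s'.
move: a b a' b' ba ba' {s s' small} => [|[|[|[|?]]]] // b [|[|[|[|?]]]] // b';
  case: b => [|[|[|[|?]]]] //; case: b' => [|[|[|[|?]]]] //; lia.
Qed.

(** * Blocks that end in a long periodic run *)

Section Marker.
Variables (blk : bool -> seq bool) (z : nat -> bool) (q M : nat) (h : bool -> nat).
Hypotheses (q_gt0 : 0 < q) (hq : forall x, h x + q <= M)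
  (szblk : forall x, size (blk x) = h x + q + M)
  (hd : forall x, nth false (blk x) 0 = true)
  (tl : forall x, nth false (blk x) (size (blk x) - q) = false)
  (per : forall x k, h x + q <= k < size (blk x) ->
     nth false (blk x) k = nth false (blk x) (k - q)).
Local Notation V := (conc blk z).

(** A break of the period [q] right after a run of it. Nothing to the right of [j] enters, so the
    test can be made inside any word that reaches [M + q] letters to the left. *)
Definition marked (W : nat -> bool) j := W j <> W (j - q) /\
  (forall t, 0 < t <= M -> W (j - t) = W (j - t - q)).

Let blk_gt0 x : 0 < size (blk x). Proof. by rewrite szblk; lia. Qed.

(** By [tl] the period predicts [false] at a cut, whereas by [hd] every block starts with [true]. *)
Let break n : V (cutpos blk z n.+1) <> V (cutpos blk z n.+1 - q).
Proof.
have -> : cutpos blk z n.+1 - q = cutpos blk z n + (size (blk (z n)) - q).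
  by rewrite cutposS szblk; lia.
rewrite -{1}(addn0 (cutpos blk z n.+1)) !concE ?hd ?tl //.
by rewrite szblk; lia.
Qed.

(** At a cut, the tail of the previous block is the run. Elsewhere, either the position is in the
    periodic tail and breaks nothing, or it is less than [M] after a cut, whose break spoils the
    run. *)
Lemma cut_marked j : M + q <= j -> is_cut blk z j <-> marked V j.
Proof.
move=> Mj; split.
  case=> -[|n] e; first by rewrite cutpos0 in e; lia.
  rewrite e; split; first exact: break.
  move=> t tM; have := szblk (z n); have := hq (z n) => h1 h2.
  have -> : cutpos blk z n.+1 - t = cutpos blk z n + (size (blk (z n)) - t).
    by rewrite cutposS; lia.
  rewrite -addnBA; last by lia.
  by rewrite !concE //; [apply: per|..]; lia.
move=> [Vj run]; have [n [[|k] [e kn]]] := locate z blk_gt0 j.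
  by exists n; lia.
exfalso; have := hq (z n) => hn.
have [hk|kh] := leqP (h (z n) + q) k.+1.
  apply: Vj; rewrite e -addnBA; last by lia.
  have kq : k.+1 - q < size (blk (z n)) by apply: leq_ltn_trans (leq_subr _ _) kn.
  by rewrite (concE blk_gt0 kn) (concE blk_gt0 kq) per // hk.
case: n e kn hn kh => [|n] e kn hn kh; first by rewrite cutpos0 in e; lia.
apply: (@break n); have := run k.+1.
by rewrite e addnK; apply; lia.
Qed.

Lemma marked_agree rho i j : M + q <= rho -> rho <= i -> rho <= j ->
  agree V rho i j -> marked V i -> marked V j.
Proof.
move=> Mr ri rj ag [Vi run].
have E s : s <= rho -> V (i - s) = V (j - s).
  move=> sr; have := ag (rho - s).
  have -> : i - rho + (rho - s) = i - s by lia.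
  have -> : j - rho + (rho - s) = j - s by lia.
  by apply; lia.
split; first by have := E 0 isT; rewrite !subn0 => <-; rewrite -E //; lia.
by move=> t tM; rewrite -subnDA -!E; [rewrite subnDA run|..]; lia.
Qed.

Lemma marked_recognizable : recognizable (M + q) blk z.
Proof.
move=> i j ri rj ag /(cut_marked ri) mi; apply/(cut_marked rj).
exact: marked_agree ag mi.
Qed.

Lemma marked_shift (W : seq bool) i j t : occurs V W i -> occurs V W j ->
  M + q <= t < size W -> is_cut blk z (i + t) -> is_cut blk z (j + t).
Proof.
move=> oi oj /andP[Mt tW] ct.
have {}ct : marked V (i + t) by apply/cut_marked => //; lia.
apply/cut_marked; first by lia.
have E s : s <= t -> V (i + t - s) = V (j + t - s).
  by move=> st; rewrite -!addnBA // oi ?oj //; lia.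
case: ct => Vi run; split; first by have := E 0 isT; rewrite !subn0 => <-; rewrite -E //; lia.
by move=> s sM; rewrite -subnDA -!E; [rewrite subnDA run|..]; lia.
Qed.

(* A cut near the end of [p] and a cut near the start of [r] are seen in [p]
   and [r] isolated_subshift; the distances between them in the two words are sums of few
   block lengths that differ by at most [C], so they coincide. *)
Lemma connecting_gap (alpha D C : nat) (p r g g' : seq bool) i j :
  (forall x, size (blk x) = alpha + x * D) -> C < D -> 4 * D + C < alpha ->
  M + q + alpha + D <= size p -> M + q + alpha + D <= size r ->
  size g <= C -> size g' <= C ->
  occurs V (p ++ g ++ r) i -> occurs V (p ++ g' ++ r) j -> size g = size g'.
Proof.
move=> sz CD Da np nr gC g'C oi oj.
have bb x : size (blk x) <= alpha + D by rewrite sz; case: x; lia.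
have occp g0 k : occurs V (p ++ g0 ++ r) k -> occurs V p k.
  by move=> o t tp; rewrite o ?nth_cat ?tp // !size_cat; lia.
have occr g0 k : occurs V (p ++ g0 ++ r) k -> occurs V r (k + size p + size g0).
  move=> o t tp; rewrite -!addnA o ?nth_cat ?size_cat; last by lia.
  by rewrite !ifN; [congr nth|..]; lia.
(* The margins [M + q] leave room for the whole marker of each cut inside [p] or [r], so both cuts
   reappear in the occurrence at [j]. *)
have [n /andP[n1 n2]] := next_cut z blk_gt0 (i + size p - alpha - D) bb.
have [m /andP[m1 m2]] := next_cut z blk_gt0 (i + size p + size g + M + q) bb.
have [n' en'] : is_cut blk z (j + (cutpos blk z n - i)).
  apply: (marked_shift (occp _ _ oi) (occp _ _ oj)); first by lia.
  by exists n; lia.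
set t := cutpos blk z m - (i + size p + size g).
have [m' em'] : is_cut blk z (j + size p + size g' + t).
  apply: (marked_shift (occr _ _ oi) (occr _ _ oj)); first by lia.
  by exists m; lia.
have le0 : cutpos blk z n <= cutpos blk z m by lia.
have le1 : cutpos blk z n' <= cutpos blk z m' by lia.
have lec u v : cutpos blk z u < cutpos blk z v -> u <= v.
  by move=> uv; rewrite leqNgt; apply/negP => /ltnW/(leq_cutpos2 blk z); lia.
have dist u v : cutpos blk z u < cutpos blk z v ->
    exists a b, b <= a /\ cutpos blk z v = cutpos blk z u + a * alpha + b * D.
  move=> /lec/subnKC <-; have [b ba ->] := cutposD z (v - u) u sz.
  by exists (v - u), b.
have sz0 := szblk false; have szf := sz false; rewrite mul0n addn0 in szf.
have [a [b [ba e1]]] : exists a b, b <= a /\ cutpos blk z m = cutpos blk z n + a * alpha + b * D by apply: dist; lia.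
have [a' [b' [ba' e2]]] : exists a b, b <= a /\ cutpos blk z m' = cutpos blk z n' + a * alpha + b * D by apply: dist; lia.
(* The two distances differ by [size g] against [size g'], hence by at most [C]; they are below
   [4 * alpha] because [M + q <= alpha]. *)
have [ea eb] : a = a' /\ b = b'; last by subst a' b'; lia.
by apply: (@block_sum_inj alpha D C) => //; lia.
Qed.
End Marker.

(* The last nonzero ternary digit of [n + 1] is [2]: the fixed point of the
   substitution [0 -> 010], [1 -> 011]. *)
Definition chacon (n : nat) : bool := (n.+1 %/ 3 ^ logn 3 n.+1) %% 3 == 2.

Lemma chacon0 n : chacon (3 * n) = false.
Proof.
have e : logn 3 (3 * n).+1 = 0 by apply: logn_coprime; rewrite prime_coprime //; lia.
by rewrite /chacon e divn1; lia.
Qed.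

Lemma chacon1 n : chacon (3 * n).+1 = true.
Proof.
have e : logn 3 (3 * n).+2 = 0 by apply: logn_coprime; rewrite prime_coprime //; lia.
by rewrite /chacon e divn1; lia.
Qed.

Lemma chacon2 n : chacon (3 * n).+2 = chacon n.
Proof.
have e : (3 * n).+3 = 3 * n.+1 by lia.
by rewrite /chacon e lognM // (pfactorK 1) // expnD divnMl.
Qed.

(** The [k]-th iterate of the substitution [0 -> 010], [1 -> 011], with blocks in place of the
    letters. *)
Fixpoint tower (blk : bool -> seq bool) (k : nat) (x : bool) : seq bool :=
  if k is l.+1 then tower blk l false ++ tower blk l true ++ tower blk l x
  else blk x.

Lemma cutpos_tower1 blk n :
  cutpos (tower blk 1) chacon n = cutpos blk chacon (3 * n).
Proof.
elim: n => [|n IH]; first by rewrite muln0 !cutpos0.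
have -> : 3 * n.+1 = (3 * n).+3 by lia.
by rewrite !cutposS chacon0 chacon1 chacon2 IH /= !size_cat; lia.
Qed.

(** Since [chacon] is fixed by the substitution, grouping the blocks by threes gives groups that
    again follow [chacon]. *)
Lemma conc_tower1 blk : (forall x, 0 < size (blk x)) ->
  conc (tower blk 1) chacon =1 conc blk chacon.
Proof.
move=> blk_gt0 i; apply/esym; move: i; apply: conc_uniq => [x|n k kn].
  by rewrite /= !size_cat; have := blk_gt0 false; lia.
rewrite cutpos_tower1; move: kn; rewrite /= !size_cat !nth_cat => kn.
have [k0|k0] := ltnP k (size (blk false)).
  by rewrite concE ?chacon0.
have [k1|k1] := ltnP (k - size (blk false)) (size (blk true)).
  have -> : cutpos blk chacon (3 * n) + k =
    cutpos blk chacon (3 * n).+1 + (k - size (blk false)).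
    by rewrite cutposS chacon0; lia.
  by rewrite concE ?chacon1.
have -> : cutpos blk chacon (3 * n) + k =
  cutpos blk chacon (3 * n).+2 + (k - size (blk false) - size (blk true)).
  by rewrite !cutposS chacon0 chacon1; lia.
by rewrite concE ?chacon2 //; lia.
Qed.

(** * Residues of occurrences in towers *)

Section Tower.
Variables (blk : bool -> seq bool) (alpha D : nat).
Hypotheses (szblk : forall x, size (blk x) = alpha + x * D) (alpha_gt0 : 0 < alpha).
Local Notation V := (conc blk chacon).
Local Notation U k := (tower blk k false).

Lemma size_tower k x : size (tower blk k x) = size (U k) + x * D.
Proof.
by elim: k x => [|k IH] x /=; [rewrite !szblk; lia|rewrite !size_cat IH (IH x); lia].
Qed.

Lemma size_towerS k : size (U k.+1) = 3 * size (U k) + D.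
Proof. by rewrite /= !size_cat (size_tower k true); lia. Qed.

Lemma size_tower_gt k : k < size (U k).
Proof. by elim: k => [|k IH]; [rewrite /= szblk; lia|rewrite size_towerS; lia]. Qed.

Lemma tower_gt0 k x : 0 < size (tower blk k x).
Proof. by rewrite size_tower; have := size_tower_gt k; lia. Qed.

Lemma conc_tower k : conc (tower blk k) chacon =1 V.
Proof.
elim: k => [//|k IH] i; rewrite -IH -(conc_tower1 (@tower_gt0 k)).
by congr (nth _ (flatten _) _); apply: eq_map.
Qed.

Lemma conc_at k n j : j < size (tower blk k (chacon n)) ->
  V (cutpos (tower blk k) chacon n + j) = nth false (tower blk k (chacon n)) j.
Proof. by move=> jn; rewrite -(conc_tower k) concE //; exact: tower_gt0. Qed.

Lemma conc_U k j : j < size (U k) -> V j = nth false (U k) j.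
Proof. by move=> jk; have := @conc_at k 0 j jk; rewrite cutpos0. Qed.

Lemma occurs_U w i : occurs V w i -> exists k l r, U k = l ++ w ++ r.
Proof.
move=> o; exists (i + size w), (take i (U (i + size w))), (drop (i + size w) (U (i + size w))).
have h := size_tower_gt (i + size w).
have ew : w = take (size w) (drop i (U (i + size w))).
  apply: (@eq_from_nth _ false) => [|t tw]; first by rewrite size_takel ?size_drop; lia.
  by rewrite nth_take // nth_drop -o // (@conc_U (i + size w)) //; lia.
by rewrite {3}ew addnC -drop_drop !cat_take_drop.
Qed.

(** The offset is kept up to congruence, so that subtraction modulo [p] can be done by adding
    multiples of [p.-1]. *)
Definition residue p w k r := exists l s, U k = l ++ w ++ s /\ size l = r %[mod p].

Lemma residueS p w k r : residue p w k r -> residue p w k.+1 r.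
Proof.
move=> [l [s [e h]]]; exists l, (s ++ tower blk k true ++ tower blk k false).
by rewrite /= e -!catA.
Qed.

Lemma residue_le p w k k' r : k <= k' -> residue p w k r -> residue p w k' r.
Proof. by move/subnKC <-; elim: (_ - _) => [|d IH]; rewrite ?addn0 ?addnS // => /IH/residueS. Qed.

(** In [U k.+2] the block that follows the first [U k.+1] also starts with [U k]. *)
Lemma residue_U p w k r : residue p w k r -> residue p w k.+2 (r + size (U k.+1)).
Proof.
move=> [l [s [e h]]].
exists (U k.+1 ++ l), (s ++ tower blk k true ++ tower blk k true ++ U k.+1).
split.
  have -> : U k.+2 = U k.+1 ++ (U k ++ tower blk k true ++ tower blk k true) ++ U k.+1 by [].
  by rewrite {1}e -!catA.
by rewrite size_cat addnC -modnDml h modnDml.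
Qed.

(** The last [U k] in [U k.+1] comes after a [U k] and a [tower blk k true]. *)
Lemma residue_UT p w k r : residue p w k r ->
  residue p w k.+1 (r + (2 * size (U k) + D)).
Proof.
move=> [l [s [e h]]]; exists (U k ++ tower blk k true ++ l), s.
split.
  have -> : U k.+1 = (U k ++ tower blk k true) ++ U k by rewrite /= catA.
  by rewrite {2}e -!catA.
rewrite !size_cat (size_tower k true).
have -> : size (U k) + (size (U k) + true * D + size l) = size l + (2 * size (U k) + D) by lia.
by rewrite -modnDml h modnDml.
Qed.

Lemma residue_modn p w k r r' : r = r' %[mod p] -> residue p w k r -> residue p w k r'.
Proof. by move=> e [l [s [? h]]]; exists l, s; rewrite h e. Qed.

Hypotheses (coD : coprime alpha D) (co3 : coprime 3 D).

Lemma coprime_tower k : coprime (size (U k)) D.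
Proof.
elim: k => [|k IH]; first by rewrite /= szblk addn0.
by rewrite size_towerS coprime_sym /coprime gcdnDr -/(coprime _ _) coprimeMr
  coprime_sym co3 coprime_sym.
Qed.


(* The residues of the offsets of [w] in the towers form an increasing sequence
   of subsets of Z/p; once it is stationary for two steps, it is invariant under
   translation by two numbers that generate Z/p. *)
Lemma residue_all p w k0 r0 : 0 < p -> residue p w k0 r0 ->
  exists k, forall r, residue p w k r.
Proof.
move=> p0 res0; have [p' ep] : exists p', p = p'.+1 by exists p.-1; lia.
pose S k := [set r : 'I_p | `[< residue p w k r >]]%SET.
have Smono k : S k \subset S k.+2.
  by apply/fintype.subsetP => r; rewrite !inE => /asboolP h; apply/asboolP; do 2 apply: residueS.
(* Without such a level, the cardinals of the sets [S (k0 + m.*2)] would increase strictly past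
   [p]. *)
have [k kk0 stable] : exists2 k, k0 <= k & S k.+2 = S k.
  apply: contrapT => nst.
  suff /(_ p.+1) : forall m, m <= #|S (k0 + m.*2)|.
    by move=> /leq_trans/(_ (max_card _)); rewrite card_ord ltnn.
  elim=> [//|m IH]; rewrite doubleS !addnS; apply: leq_ltn_trans IH _.
  apply: proper_card; rewrite finset.properEneq Smono andbT; apply/eqP => e.
  by apply: nst; exists (k0 + m.*2); rewrite ?leq_addr.
have resS k' r : residue p w k' r <-> Ordinal (ltn_pmod r p0) \in S k'.
  rewrite inE; split=> [h|/asboolP]; first by apply/asboolP; apply: residue_modn h; rewrite /= modn_mod.
  by apply: residue_modn; rewrite /= modn_mod.
have back r : residue p w k.+2 r -> residue p w k r by move/resS; rewrite stable => /resS.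
set h := size (U k.+1).
have addh r : residue p w k r -> residue p w k (r + h).
  by move=> /residue_U/back.
have addhD r : residue p w k r -> residue p w k (r + (2 * h + D)).
  by move=> /residueS/residue_UT/back.
have addhn m r : residue p w k r -> residue p w k (r + m * h).
  elim: m r => [|m IH] r; first by rewrite addn0.
  by move=> /IH/addh; rewrite mulSn; congr residue; lia.
(* Subtracting [2 * h] modulo [p] amounts to adding [h] another [2 * (p - 1)] times. *)
have addD r : residue p w k r -> residue p w k (r + D).
  move=> /addhD/(addhn ((p.-1).*2)); apply: residue_modn.
  have -> : r + (2 * h + D) + p.-1.*2 * h = (2 * h) * p + (r + D).
    by rewrite -muln2 ep /=; lia.
  by rewrite modnMDl.
have addDn m r : residue p w k r -> residue p w k (r + m * D).
  elim: m r => [|m IH] r; first by rewrite addn0.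
  by move=> /IH/addD; rewrite mulSn; congr residue; lia.
(* Bezout for the coprime [h] and [D]: adding [u * h] and subtracting [v * D] is a translation by
   one. *)
have [u v uv _] := egcdnP D (tower_gt0 k.+1 false).
have {}uv : u * h = v * D + 1 by rewrite uv (eqP (coprime_tower k.+1)).
have add1 r : residue p w k r -> residue p w k r.+1.
  move=> /(addhn u)/(addDn (v * p.-1)); apply: residue_modn.
  have -> : r + u * h + v * p.-1 * D = (v * D) * p + r.+1.
    by rewrite uv ep /=; lia.
  by rewrite modnMDl.
exists k => r; have {}res0 := residue_le kk0 res0.
have : residue p w k (r0 + (r + r0 * p.-1)).
  elim: (r + _) => [|m IH]; first by rewrite addn0.
  by rewrite addnS; apply: add1.
apply: residue_modn.
have -> : r0 + (r + r0 * p.-1) = r0 * p + r by rewrite ep /=; lia.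
by rewrite modnMDl.
Qed.

(** Every block of level [k.+1] starts with [U k], where [w] has offsets of all residues. After the
    next such block boundary, at distance [t], an offset congruent to [- t] is taken. *)
Lemma syndetic_occurrences p w i0 : 0 < p -> occurs V w i0 ->
  exists L, forall i, exists2 j, j < L & (p %| j) /\ occurs V w (i + j).
Proof.
move=> p0 /occurs_U[k0 [l0 [s0 e0]]].
have [|k res] := @residue_all p w k0 (size l0) p0; first by exists l0, s0.
set beta := size (tower blk k.+1 true).
have bb x : size (tower blk k.+1 x) <= beta.
  by rewrite /beta (size_tower _ x) (size_tower _ true); case: x; lia.
exists (beta + size (U k)) => i.
have [n /andP[n1 n2]] := next_cut chacon (@tower_gt0 k.+1) i bb.
set t := cutpos (tower blk k.+1) chacon n - i.
have [l [s [e lp]]] := res (t * p.-1).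
have sU : size (U k) = size l + size w + size s by rewrite e !size_cat addnA.
have occ : occurs V w (i + (t + size l)).
  move=> j jw; have -> : i + (t + size l) + j =
     cutpos (tower blk k.+1) chacon n + (size l + j) by lia.
  have Us x : size (U k) <= size (tower blk k.+1 x) by rewrite /= size_cat leq_addr.
  rewrite conc_at; last by apply: leq_trans (Us _); lia.
  rewrite /= nth_cat ifT; last by lia.
  by rewrite e nth_cat ltnNge leq_addr /= addKn nth_cat jw.
exists (t + size l).
  by rewrite /t; lia.
split=> //.
rewrite /dvdn -modnDmr lp modnDmr -{1}(muln1 t) -mulnDr add1n prednK //.
by rewrite modnMl.
Qed.

End Tower.

(** * The spaces of sequences and of subshifts *)

Local Open Scope classical_set_scope.
Local Open Scope ring_scope.

Definition agree_on (N : nat) (x y : fullshift) : Prop :=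
  forall i : int, (`|i| <= N)%N -> x i = y i.

Lemma entourage_coord (i : int) :
  entourage [set xy : fullshift * fullshift | xy.1 i = xy.2 i].
Proof.
pose T : int -> uniformType := fun=> bool.
have ent : @entourage (initial_topology (@proj _ T i))
    [set xy : fullshift * fullshift | xy.1 i = xy.2 i].
  exists [set ab : bool * bool | ab.1 = ab.2] => //.
  by rewrite uniform_discrete => _ [a _ <-].
rewrite /entourage /= /sup_ent.
have ent' : `[< @entourage (initial_topology (@proj _ T i))
    [set xy : fullshift * fullshift | xy.1 i = xy.2 i] >] by exact/asboolP.
match goal with |- filter_from (@finI_from ?J ?U ?D ?f) _ _ =>
  pose p : J := exist _ (i, [set xy : fullshift * fullshift | xy.1 i = xy.2 i]) ent';
  by exists (f p) => //; exact: finI_from1 end.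
Qed.

Lemma entourage_agree_on (N : nat) :
  entourage [set xy : fullshift * fullshift | agree_on N xy.1 xy.2].
Proof.
elim: N => [|N IH].
  apply: filterS (entourage_coord 0) => -[x y] /= xy i i0.
  by have -> : i = 0 by lia.
apply: (filterS _ (filterI IH (filterI (entourage_coord N.+1%:Z)
  (entourage_coord (- N.+1%:Z))))).
move=> [x y] /= [xy [xy1 xy2]] i iN.
have [|iN'] := leqP `|i|%N N; first exact: xy.
have [->|->] : i = N.+1%:Z \/ i = - N.+1%:Z by lia.
- exact: xy1.
- exact: xy2.
Qed.

(** A basic entourage constrains finitely many coordinates; [N] bounds their absolute values. *)
Lemma entourage_fullshift (E : set (fullshift * fullshift)) : entourage E ->
  exists N : nat, forall x y, agree_on N x y -> E (x, y).
Proof.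
case=> D [F _ <-] FE.
exists (\max_(p <- enum_fset F) `|(projT1 p).1 : int|%N)%N => x y xy; apply: FE => p pF; have := @leq_bigmax_seq _ (enum_fset F) xpredT (fun p => `|(projT1 p).1 : int|%N) _ pF isT.
case: p pF => -[i D'] entD pF /= iF; have [W entW WD] := asboolW entD.
apply: WD.
have xyi : x i = y i by apply: xy; exact: iF.
suff : W (x i, y i) by [].
by rewrite xyi; exact: entourage_refl.
Qed.

Lemma nbhs_fullshiftP (x : fullshift) (A : set fullshift) :
  nbhs x A <-> exists N, forall y, agree_on N x y -> A y.
Proof.
split=> [/nbhsP[E entE EA]|[N NA]].
  have [N HN] := entourage_fullshift entE; exists N => y xy; apply: EA.
  by apply/xsectionP; exact: HN.
apply/nbhsP; exists [set xy | agree_on N xy.1 xy.2]; first exact: entourage_agree_on.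
by move=> y /xsectionP; exact: NA.
Qed.

Lemma closure_fullshiftP (X : set fullshift) x :
  closure X x <-> forall N, exists2 y, X y & agree_on N x y.
Proof.
split=> [cX N|H B /nbhs_fullshiftP[N NB]].
  have /cX[y [Xy xy]] : nbhs x [set y | agree_on N x y] by apply/nbhs_fullshiftP; exists N.
  by exists y.
by have [y Xy xy] := H N; exists y; split => //; exact: NB.
Qed.

(** Compactness of the full shift, from Tychonoff's theorem, in the sequential form used by all
    limit arguments below. *)
Lemma fullshift_cluster (u : nat -> fullshift) :
  exists x, forall N k, exists2 l, (k <= l)%N & agree_on N x (u l).
Proof.
have cT : compact [set: fullshift].
  have := @tychonoff int (fun=> bool) (fun=> setT) (fun=> bool_compact).
  by congr compact; apply/seteqP; split.
have [|x [_ xu]] := cT (u @ \oo); first exact: filterT.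
exists x => N k.
have nx : nbhs x [set y | agree_on N x y] by apply/nbhs_fullshiftP; exists N.
have [|_ [/= [l kl <-] xl]] := xu (u @` [set l | (k <= l)%N]) _ _ nx.
  by exists k => // l kl; exists l.
by exists l.
Qed.

(** * Languages *)

Definition reads (x : fullshift) (w : seq bool) (i : int) : Prop :=
  forall k, (k < size w)%N -> x (i + k%:Z) = nth false w k.

Definition lang (X : set fullshift) (w : seq bool) : Prop :=
  exists2 x, X x & reads x w 0.

Definition window (x : fullshift) (i : int) (n : nat) : seq bool :=
  mkseq (fun k => x (i + k%:Z)) n.

Lemma reads_window x i n : reads x (window x i n) i.
Proof. by move=> k; rewrite size_mkseq => kn; rewrite nth_mkseq. Qed.

Lemma size_window x i n : size (window x i n) = n.
Proof. exact: size_mkseq. Qed.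

Lemma reads_cat x u v i : reads x (u ++ v) i <-> reads x u i /\ reads x v (i + (size u)%:Z).
Proof.
split=> [r|[ru rv] k].
  split=> k ks; first by rewrite r ?nth_cat ?ks // size_cat; lia.
  rewrite -addrA -PoszD r ?nth_cat ?size_cat; last by lia.
  by rewrite ltnNge leq_addr /= addKn.
rewrite size_cat nth_cat => ks; case: ltnP => ku; first exact: ru.
by rewrite -rv; [congr x|]; lia.
Qed.

Lemma reads_shiftz x w i k : reads (shiftz k x) w i <-> reads x w (i + k).
Proof.
by split=> r t tw; rewrite -r // /shiftz; congr x; lia.
Qed.

Lemma shiftzD k l x : shiftz k (shiftz l x) = shiftz (k + l) x.
Proof. by apply/funext => i; rewrite /shiftz addrA. Qed.

Lemma shiftz0 x : shiftz 0 x = x.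
Proof. by apply/funext => i; rewrite /shiftz addr0. Qed.

Lemma invariant_shiftz (X : set fullshift) : Defs.shift @` X = X ->
  forall k x, X x -> X (shiftz k x).
Proof.
move=> sX.
have fw x : X x -> X (shiftz 1 x) by move=> Xx; rewrite -sX; exists x.
have bw x : X x -> X (shiftz (-1) x).
  by rewrite -{1}sX => -[y Xy <-]; rewrite /Defs.shift shiftzD addNr shiftz0.
have P (n : nat) x : X x -> X (shiftz n x) /\ X (shiftz (- n%:Z) x).
  move=> Xx; elim: n => [|n [h1 h2]]; first by rewrite oppr0 shiftz0.
  split.
    by move/fw: h1; rewrite shiftzD.
  have -> : - n.+1%:Z = -1 + - n%:Z by lia.
  by rewrite -shiftzD; exact: bw.
move=> k x Xx; case: (intP k) => [|n|n]; first by rewrite shiftz0.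
- by have [] := P n.+1 x Xx.
- by have [] := P n.+1 x Xx.
Qed.

Lemma shiftz_invariant (X : set fullshift) : (forall k x, X x -> X (shiftz k x)) ->
  Defs.shift @` X = X.
Proof.
move=> sX; apply/seteqP; split=> [_ [x Xx <-]|x Xx]; first exact: sX.
by exists (shiftz (-1) x); [exact: sX|rewrite /Defs.shift shiftzD subrr shiftz0].
Qed.

Definition mk_subshift (X : set fullshift) (cX : closed X)
    (sX : forall k x, X x -> X (shiftz k x)) : subshift :=
  exist _ X (mem_set (conj cX (shiftz_invariant sX))).

Lemma subshift_closure (X : subshift) x : closure (set_val X) x -> set_val X x.
Proof. by have [cX _] := set_valP X; exact: cX. Qed.

Lemma subshift_shiftz (X : subshift) k x : set_val X x -> set_val X (shiftz k x).
Proof. by apply: invariant_shiftz; have [] := set_valP X. Qed.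

Lemma subshift_eq (X Y : subshift) : set_val X = set_val Y -> X = Y.
Proof. by move=> e; apply: val_inj. Qed.

(** The ball of radius [2 ^ (- n)] of the language metric, in a form free of real numbers. *)
Definition close (n : nat) (X Y : subshift) : Prop :=
  forall w, (size w <= n)%N -> lang (set_val X) w <-> lang (set_val Y) w.

Lemma close_sym n X Y : close n X Y -> close n Y X.
Proof. by move=> h w /h[]. Qed.

Lemma close_trans n X Y Z : close n X Y -> close n Y Z -> close n X Z.
Proof. by move=> h1 h2 w wn; rewrite h1 // h2. Qed.

Lemma close_le m n X Y : (m <= n)%N -> close n X Y -> close m X Y.
Proof. by move=> mn h w wm; apply: h; exact: leq_trans mn. Qed.

Section Language.
Variable X : subshift.
Local Notation L := (lang (set_val X)).

Lemma lang_reads x w i : set_val X x -> reads x w i -> L w.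
Proof.
by move=> Xx r; exists (shiftz i x); [exact: subshift_shiftz|rewrite reads_shiftz add0r].
Qed.

Lemma lang_window x i n : set_val X x -> L (window x i n).
Proof. by move=> Xx; apply: (lang_reads Xx); exact: reads_window. Qed.

Lemma lang_at w i : L w -> exists2 x, set_val X x & reads x w i.
Proof.
move=> [x Xx r]; exists (shiftz (- i) x); first exact: subshift_shiftz.
by rewrite reads_shiftz subrr.
Qed.

Lemma lang_infix u w v : L (u ++ w ++ v) -> L w.
Proof. by move=> [x Xx]; rewrite !reads_cat => -[_ [r _]]; exact: lang_reads Xx r. Qed.

Lemma lang_prefix w v : L (w ++ v) -> L w.
Proof. exact: (@lang_infix [::]). Qed.

Lemma lang_extend m n w : L w ->
  exists u v, [/\ size u = m, size v = n & L (u ++ w ++ v)].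
Proof.
move=> [x Xx r]; exists (window x (- m%:Z) m), (window x (size w)%:Z n).
rewrite !size_window; split=> //; apply: (@lang_reads x _ (- m%:Z)) => //.
rewrite !reads_cat size_window; split; first exact: reads_window.
by rewrite addNr; split=> //; rewrite add0r; exact: reads_window.
Qed.

End Language.

Lemma agree_reads N x y w i : agree_on N x y -> (`|i| + size w <= N)%N ->
  reads x w i -> reads y w i.
Proof. by move=> xy iw r k kw; rewrite -xy ?r //; lia. Qed.

(** The Hausdorff and language metrics give the same topology: by shift invariance, the words of
    length [N.*2.+1] are those read on the coordinates from [-N] to [N]. *)
Lemma nbhs_subshiftP (X : subshift) (A : set subshift) :
  nbhs X A <-> exists n, forall Y, close n X Y -> A Y.
Proof.
split=> [/nbhsP[E [D entD DE] EA]|[n nA]].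
  have [N HN] := entourage_fullshift entD; exists N.*2.+1 => Y XY.
  apply: EA; apply/xsectionP; apply: DE.
  have near (Z1 Z2 : subshift) x : close N.*2.+1 Z1 Z2 -> set_val Z1 x ->
      exists2 y, set_val Z2 y & agree_on N x y.
    move=> ZZ Zx; have := lang_window (- N%:Z) N.*2.+1 Zx.
    rewrite ZZ ?size_window // => /(lang_at (- N%:Z))[y Zy r]; exists y => // i iN.
    have := r (absz (i + N%:Z)); rewrite size_window nth_mkseq; last by lia.
    have -> : - N%:Z + (absz (i + N%:Z))%:Z = i by lia.
    by move=> -> //; lia.
  split=> [x|y] /= H.
    by have [y Yy xy] := near _ _ _ XY H; exists y => //; exact: HN.
  have [x Xx yx] := near _ _ _ (close_sym XY) H; exists x => //.
  by apply: HN => i iN; rewrite yx.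
apply/nbhsP; exists (hausdorff_ent [set xy | agree_on n xy.1 xy.2]).
  by exists [set xy | agree_on n xy.1 xy.2] => //; exact: entourage_agree_on.
move=> Y /xsectionP[/= XY YX]; apply: nA => w wn; split=> -[x Zx r].
  have [y Yy xy] := XY x Zx; exists y => //; exact: agree_reads xy _ r.
have [y Yy xy] := YX x Zx; exists y => //; apply: (@agree_reads n x y) r => // i iN.
by rewrite -(xy i iN).
Qed.

Definition isolated_subshift (X : subshift) := exists n, forall Y, close n X Y -> Y = X.

Lemma isolated_subshiftP X : S2' X <-> ~ isolated_subshift X.
Proof.
rewrite /S2' /=; split=> h1 h2; apply: h1.
  split; first exact: mem_set.
  case: h2 => n nX; exists [set X]; last by rewrite setIT.
  by apply/nbhs_subshiftP; exists n => Y /nX.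
case: h2 => _ [V /nbhs_subshiftP[n nV]]; rewrite setIT => VX.
by exists n => Y /nV; rewrite VX.
Qed.

(** * Approximations of finite type *)

Section SFT.
Variables (n : nat) (L : set (seq bool)).

Definition windows_in : set fullshift := [set x | forall i, L (window x i n)].

Lemma windows_in_closed : closed windows_in.
Proof.
move=> x /closure_fullshiftP cx i.
have [y Sy xy] := cx (`|i| + n)%N.
rewrite (_ : window x i n = window y i n) //; apply/eq_in_map => k.
by rewrite mem_iota => kn; apply: xy; lia.
Qed.

Lemma windows_in_shiftz k x : windows_in x -> windows_in (shiftz k x).
Proof.
move=> Sx i; have := Sx (i + k); congr (L _); apply: eq_mkseq => j.
by rewrite /shiftz; congr x; lia.
Qed.

Definition sft : subshift := mk_subshift windows_in_closed windows_in_shiftz.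

End SFT.

Lemma lang_sft n L w : lang (windows_in n L) w -> (size w = n)%N -> L w.
Proof.
move=> [x Sx r] wn; have := Sx 0; congr (L _); rewrite -wn.
by apply: (@eq_from_nth _ false); rewrite size_mkseq // => k kn; rewrite nth_mkseq // r.
Qed.

Lemma sub_sft n (X : subshift) : set_val X `<=` windows_in n (lang (set_val X)).
Proof. by move=> x Xx i; exact: lang_window. Qed.

(** An isolated subshift therefore equals one of these approximations, which is how specific points
    are shown to lie in it. *)
Lemma close_sft n (X : subshift) : close n X (sft n (lang (set_val X))).
Proof.
move=> w wn; split=> [[x Xx r]|].
  by exists x => //; exact: sub_sft.
move=> /(@lang_extend (sft n _) 0 (n - size w))[u [v [/size0nil-> vn /lang_sft]]].
by rewrite /= size_cat vn subnKC // => /(_ erefl)/lang_prefix.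
Qed.

(** * Periodic points and isolation *)

Definition periodic (H : nat) (x : fullshift) := forall i, x (i + H%:Z) = x i.

Lemma periodicM H x i (k : int) : periodic H x -> x (i + k * H%:Z) = x i.
Proof.
move=> px.
have P (m : nat) j : x (j + m%:Z * H%:Z) = x j.
  elim: m j => [|m IH] j; first by rewrite mul0r addr0.
  by rewrite -[RHS]IH -[RHS]px; congr x; lia.
have [m [->|->]] : exists m : nat, k = m%:Z \/ k = - m%:Z by exists `|k|%N; lia.
  exact: P.
by rewrite -[LHS](P m); congr x; lia.
Qed.

Lemma periodic_eq H x y : (0 < H)%N -> periodic H x -> periodic H y ->
  (forall k : nat, (k < H)%N -> x k = y k) -> x = y.
Proof.
move=> H0 px py xy; apply/funext => i.
have e : i = (absz (i %% H%:Z)%Z)%:Z + (i %/ H%:Z)%Z * H%:Z.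
  by rewrite gez0_abs ?modz_ge0 ?[LHS](divz_eq i H%:Z) 1?addrC //; lia.
rewrite e !periodicM // xy //.
by rewrite -ltz_nat gez0_abs ?modz_ge0 ?ltz_mod //; lia.
Qed.

Lemma minimal_lang_reads (X : subshift) x w : minimal (set_val X) -> set_val X x ->
  lang (set_val X) w -> exists i, reads x w i.
Proof.
move=> mX Xx [y Xy r]; have /closure_fullshiftP/(_ (size w))[_ [k _ <-] yk] := mX x Xx y Xy.
exists (1%:Z * k); rewrite -[1%:Z * k]add0r -reads_shiftz.
by apply: agree_reads yk _ r; rewrite absz0.
Qed.

(** All words of [X] occur in [x], so those of length [H.+1] force the period [H]. A neighbour thus
    consists of points of period [H] whose words of length [H] occur in [X]; it lies in [X], and
    minimality gives equality. *)
Lemma minimal_periodic_isolated (X : subshift) H x : minimal (set_val X) ->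
  (0 < H)%N -> set_val X x -> periodic H x -> isolated_subshift X.
Proof.
move=> mX H0 Xx px.
have perL w : lang (set_val X) w -> size w = H.+1 -> nth false w H = nth false w 0.
  move=> /(minimal_lang_reads mX Xx)[i r] wH.
  by rewrite -!r ?wH // addr0 px.
have perX y : (forall i, lang (set_val X) (window y i H.+1)) -> periodic H y.
  move=> h i; have := perL _ (h i) (size_window _ _ _).
  by rewrite !nth_mkseq // addr0.
exists H.+1 => Y XY; apply/esym/subshift_eq.
have perY y : set_val Y y -> periodic H y.
  by move=> Yy; apply: perX => i; rewrite XY ?size_window //; exact: lang_window.
have YX : set_val Y `<=` set_val X.
  move=> y Yy; have := lang_window 0 H Yy; rewrite -XY ?size_window // => -[z Xz r].
  rewrite (_ : y = z) //; apply: (@periodic_eq H) => //; first exact: perY.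
    by apply: perX => i; exact: lang_window.
  by move=> k kH; have := r k; rewrite size_window nth_mkseq // add0r => ->.
apply/seteqP; split=> // z Xz.
have := lang_window 0 H.+1 Xx; rewrite XY ?size_window // => -[y Yy _].
apply: subshift_closure; apply/closure_fullshiftP => N.
have /closure_fullshiftP/(_ N)[_ [k _ <-] zk] := mX y (YX y Yy) z Xz.
by exists (shiftz (1%:Z * k) y) => //; exact: subshift_shiftz.
Qed.

(** * Word closures and block codes *)

Lemma word_closureP V x : word_closure V x <->
  forall i n, exists j, forall k, (k < n)%N -> x (i + k%:Z) = V (j + k)%N.
Proof.
split=> h i n; have [j e] := h i n; exists j.
  move=> k kn; by move/(congr1 (fun s => nth false s k)): e; rewrite !nth_mkseq.
by apply/eq_in_map => k; rewrite mem_iota => /e.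
Qed.

Lemma word_closure_closed V : closed (word_closure V).
Proof.
move=> x /closure_fullshiftP cx; apply/word_closureP => i n.
have [y /word_closureP/(_ i n)[j Vj] xy] := cx (`|i| + n)%N.
by exists j => k kn; rewrite -Vj // xy //; lia.
Qed.

Lemma word_closure_shiftz V k x : word_closure V x -> word_closure V (shiftz k x).
Proof.
move=> /word_closureP Vx; apply/word_closureP => i n; have [j h] := Vx (i + k) n.
by exists j => t /h <-; rewrite /shiftz addrAC.
Qed.

Definition word_subshift V : subshift :=
  mk_subshift (@word_closure_closed V) (@word_closure_shiftz V).

Lemma lang_word_closure V w : lang (word_closure V) w -> exists j, occurs V w j.
Proof.
move=> [x /word_closureP Vx r]; have [j h] := Vx 0 (size w).
by exists j => k kw; rewrite -h // r.
Qed.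

(** Points of the closure are two-sided: recurrence provides occurrences of [w] with arbitrarily
    long pasts, and a cluster point of these is taken. *)
Lemma occurs_word_closure V w i : occurs V w i ->
  (forall w i, occurs V w i -> forall n, exists2 j, (n <= j)%N & occurs V w j) ->
  lang (word_closure V) w.
Proof.
move=> o recV; have {}recV n : {j | (n <= j)%N & occurs V w j}.
  by apply: cid2; exact: recV o n.
(* The occurrence chosen for [n] is at a position at least [n], so [absz] changes nothing at
   coordinates of absolute value at most [n]. *)
pose u n : fullshift := fun t => V (absz ((s2val (recV n))%:Z + t)).
have [x xu] := fullshift_cluster u.
exists x.
  apply/word_closureP => a n.
  have [l al xl] := xu (`|a| + n)%N (`|a| + n)%N.
  exists (absz ((s2val (recV l))%:Z + a)) => k kn.
  rewrite xl; last by lia.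
  by rewrite /u; congr V; have := s2valP (recV l); lia.
have [l _ xl] := xu (size w) 0%N; move=> k kw.
rewrite xl; last by lia.
by rewrite -(s2valP' (recV l)) // /u; congr V; lia.
Qed.

Lemma syndetic_dense V : (forall p w i0, (0 < p)%N -> occurs V w i0 ->
    exists L, forall i, exists2 j, (j < L)%N & (p %| j)%N /\ occurs V w (i + j)) ->
  forall p x, (0 < p)%N -> word_closure V x ->
  word_closure V `<=` closure (shift_orbit p x).
Proof.
move=> syn p x p0 /word_closureP Vx y Vy; apply/closure_fullshiftP => N.
have [i0 o] : exists j, occurs V (window y (- N%:Z) N.*2.+1) j.
  by apply: lang_word_closure; exact: (@lang_window (word_subshift V)).
have [L synL] := syn p _ i0 p0 o.
have [j0 h] := Vx (- N%:Z) (L + N.*2.+1)%N.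
have [j jL [/dvdnP[q jq] oj]] := synL j0.
exists (shiftz (p%:Z * q%:Z) x); first by exists q%:Z.
move=> i iN; have := oj (absz (i + N%:Z)); rewrite size_window.
have iN' : (absz (i + N%:Z)%R < N.*2.+1)%N by lia.
move=> /(_ iN'); rewrite nth_mkseq // => e.
have -> : y i = y (- N%:Z + (absz (i + N%:Z))%:Z) by congr y; lia.
rewrite -e -addnA -h; last by lia.
by rewrite /shiftz; congr x; lia.
Qed.

Section BlockCode.
Variables (rho : nat) (V W : nat -> bool).
Hypothesis VW : block_factor rho V W.

(** Any matching [j] gives the same value, by [VW]; a window absent from [V] yields [false]. *)
Definition block_code (x : fullshift) : fullshift := fun i =>
  `[< exists j, [/\ (rho <= j)%N,
     forall t, (t <= rho.*2)%N -> x (i - rho%:Z + t%:Z) = V (j - rho + t)%N & W j] >].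

Lemma block_codeE x i j : (rho <= j)%N ->
  (forall t, (t <= rho.*2)%N -> x (i - rho%:Z + t%:Z) = V (j - rho + t)%N) ->
  block_code x i = W j.
Proof.
move=> rj xV; apply/asboolP/idP => [[l [rl xl Wl]]|Wj]; last by exists j.
by rewrite (VW rj rl) // => t tr; rewrite -xV // xl.
Qed.

Lemma block_code_word x i j n : (forall k, (k < rho.*2 + n)%N -> x (i - rho%:Z + k%:Z) = V (j + k)%N) ->
  forall k, (k < n)%N -> block_code x (i + k%:Z) = W (j + rho + k)%N.
Proof.
move=> xV k kn; apply: block_codeE => [|t tr]; first by lia.
have -> : i + k%:Z - rho%:Z + t%:Z = i - rho%:Z + (k + t)%:Z by lia.
by rewrite xV; [congr V|]; lia.
Qed.

Lemma block_code_closure x : word_closure V x -> word_closure W (block_code x).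
Proof.
move=> /word_closureP Vx; apply/word_closureP => i n.
have [j h] := Vx (i - rho%:Z) (rho.*2 + n)%N.
by exists (j + rho)%N; exact: block_code_word.
Qed.

Lemma block_code_continuous : continuous block_code.
Proof.
move=> x A /nbhs_fullshiftP[N NA]; apply/nbhs_fullshiftP; exists (N + rho)%N => y xy.
apply: NA => i iN; apply: asbool_equiv_eq.
by split=> -[j [rj h Wj]]; exists j; split=> // t tr; rewrite -h // xy //; lia.
Qed.

Lemma block_code_shift x : block_code (Defs.shift x) = Defs.shift (block_code x).
Proof.
apply/funext => i; apply: asbool_equiv_eq.
by split=> -[j [rj h Wj]]; exists j; split=> // t tr; rewrite -h // /Defs.shift /shiftz; congr x; lia.
Qed.

End BlockCode.

Lemma block_codeK rho rho' V W : block_factor rho V W -> block_factor rho' W V ->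
  forall x, word_closure V x -> block_code rho' W V (block_code rho V W x) = x.
Proof.
move=> VW WV x /word_closureP Vx; apply/funext => i.
have [j h] := Vx (i - rho'%:Z - rho%:Z) (rho.*2 + rho'.*2.+1)%N.
rewrite (@block_codeE rho' W V WV _ i (j + rho + rho')%N); first last.
- move=> t tr; rewrite (@block_code_word rho V W VW x (i - rho'%:Z) j rho'.*2.+1) //.
  by rewrite addnK.
- by rewrite leq_addl.
by rewrite -addnA -h; [congr x|]; lia.
Qed.

Lemma block_factor_conjugate rho rho' V W :
  block_factor rho V W -> block_factor rho' W V ->
  Defs.conjugate (word_closure V) (word_closure W).
Proof.
move=> VW WV; exists (block_code rho V W), (block_code rho' W V); split.
- by split=> x; exact: block_code_closure.
- by split=> x /set_mem Vx; exact: block_codeK.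
- by split; apply: continuous_subspaceT; exact: block_code_continuous.
- by move=> x _; exact: block_code_shift.
Qed.

(** The argument of Curtis, Hedlund and Lyndon: if no radius works, counterexamples for all radii
    cluster at a point of [X] where [g] is not continuous. *)
Lemma closed_code (X : set fullshift) (g : fullshift -> fullshift) : closed X ->
  {within X, continuous g} ->
  exists m, forall x y, X x -> X y -> agree_on m x y -> g x 0 = g y 0.
Proof.
move=> cX /subspace_continuousP gc; apply: contrapT => /forallNP nm.
have bad m : exists xy : fullshift * fullshift,
    [/\ X xy.1, X xy.2, agree_on m xy.1 xy.2 & g xy.1 0 <> g xy.2 0].
  apply: contrapT => h; apply: (nm m) => x y Xx Xy xy; apply: contrapT => gxy.
  by apply: h; exists (x, y).
have [u uP] := choice bad.
have [x xu] := fullshift_cluster (fun n => (u n).1).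
have Xx : X x.
  apply: cX; apply/closure_fullshiftP => N; have [l _ xl] := xu N 0%N.
  by exists (u l).1 => //; case: (uP l).
have nb : nbhs (g x) [set y | agree_on 0 (g x) y] by apply/nbhs_fullshiftP; exists 0%N.
have /nbhs_fullshiftP[N HN] := gc x Xx _ nb.
have [l Nl xl] := xu N N; have [X1 X2 a12 ne] := uP l.
have e1 : g x 0 = g (u l).1 0 by exact: (HN _ xl X1).
have e2 : g x 0 = g (u l).2 0.
  by apply: (HN (u l).2 _ X2) => // i iN; rewrite xl // a12 //; lia.
by apply: ne; rewrite -e1 -e2.
Qed.

(** * Gaps in minimal rank-1 subshifts *)

Lemma occurs_infix V a w b i : occurs V (a ++ w ++ b) i -> occurs V w (i + size a).
Proof.
move=> o k kw; have := o (size a + k)%N; rewrite addnA => ->.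
  by rewrite nth_cat ltnNge leq_addr /= addKn nth_cat kw.
by rewrite !size_cat; lia.
Qed.

Section Rank1.
Variables (r : nat -> nat) (s : nat -> nat -> nat) (V : nat -> bool).
Hypotheses (r_gt1 : forall n, (1 < r n)%N)
  (HV : forall n, mkseq V (size (rank1_block r s n)) = rank1_block r s n).
Local Notation v := (rank1_block r s).

Lemma rank1_occurs n : occurs V (v n) 0.
Proof. by move=> k kn; rewrite add0n -(HV n) nth_mkseq. Qed.

Lemma flatten_prefix (u : seq bool) (f : nat -> seq bool) t :
  exists b, flatten [seq u ++ f i | i <- t] ++ u = u ++ b.
Proof.
case: t => [|i t]; first by exists [::]; rewrite cats0.
by rewrite /= -!catA; eexists.
Qed.

Lemma rank1_block_prefix n m : (n <= m)%N -> exists b, v m = v n ++ b.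
Proof.
move=> /subnKC <-; elim: (m - n)%N => [|k [b IH]]; first by exists [::]; rewrite addn0 cats0.
have [b' e] := flatten_prefix (v (n + k)) (fun i => nseq (s (n + k) i) true) (iota 1 (r (n + k)).-1).
by exists (b ++ b'); rewrite addnS /= e IH catA.
Qed.

Lemma rank1_block_suffix n m : (n <= m)%N -> exists a, v m = a ++ v n.
Proof.
move=> /subnKC <-; elim: (m - n)%N => [|k [a IH]]; first by exists [::]; rewrite addn0.
by rewrite addnS /= {2}IH catA; eexists.
Qed.

Lemma rank1_block_spacer m i : (0 < i < r m)%N ->
  exists a b, v m.+1 = a ++ (v m ++ nseq (s m i) true ++ v m) ++ b.
Proof.
move=> /andP[i0 im].
have -> : v m.+1 = flatten [seq v m ++ nseq (s m i) true | i <- iota 1 (r m).-1] ++ v m by [].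
have -> : (r m).-1 = (i.-1 + (1 + (r m - i.+1)))%N by lia.
rewrite !iotaD !map_cat !flatten_cat /=.
have [b e] := flatten_prefix (v m) (fun i => nseq (s m i) true) (iota (1 + i.-1 + 1) (r m - i.+1)).
have -> : (1 + i.-1)%N = i by lia.
by eexists; exists b; rewrite -!catA; rewrite (_ : (1 + i.-1)%N = i) in e; [rewrite e|lia].
Qed.

Lemma rank1_spacer_occurs n m i : (n <= m)%N -> (0 < i < r m)%N ->
  exists j, occurs V (v n ++ nseq (s m i) true ++ v n) j.
Proof.
move=> nm /rank1_block_spacer[a [b e]].
have [c ec] := rank1_block_prefix nm; have [d ed] := rank1_block_suffix nm.
have := @rank1_occurs m.+1; rewrite {}e => /occurs_infix.
rewrite {1}ed ec => o; eexists; apply: (@occurs_infix _ d _ c).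
by move: o; rewrite -!catA; apply.
Qed.

Lemma ltn_size_rank1_block n : (n < size (v n))%N.
Proof.
elim: n => [//|n IH].
have [|a [b ->]] := @rank1_block_spacer n 1; first by rewrite r_gt1.
by rewrite !size_cat; lia.
Qed.

(** A block that contains [w] is a suffix of all later blocks, which moves its occurrences
    arbitrarily far to the right. *)
Lemma rank1_recurrent w i : occurs V w i -> forall n, exists2 j, (n <= j)%N & occurs V w j.
Proof.
move=> o n.
have [a [b e]] : exists a b, v (i + size w) = a ++ w ++ b.
  exists (take i (v (i + size w))), (drop (i + size w) (v (i + size w))).
  have lt := ltn_size_rank1_block (i + size w).
  have ew : w = take (size w) (drop i (v (i + size w))).
    apply: (@eq_from_nth _ false) => [|t tw]; first by rewrite size_takel ?size_drop; lia.
    by rewrite nth_take // nth_drop -o // -(@rank1_occurs (i + size w)) //; lia.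
  by rewrite {3}ew addnC -drop_drop !cat_take_drop.
set M := (i + size w)%N in e *.
have MM : (M <= size (v M) + n)%N by have := ltn_size_rank1_block M; lia.
have [c ec] := rank1_block_suffix MM.
have := ltn_size_rank1_block (size (v M) + n).
rewrite ec size_cat => cn; exists (0 + size c + size a)%N; first by lia.
have := @rank1_occurs (size (v M) + n); rewrite ec -(cats0 (v M)).
by move=> /occurs_infix; rewrite e => /occurs_infix.
Qed.

(** With a constant spacer from level [n] on, every later block is a power of [P] followed by
    [v n]. *)
Lemma rank1_periodic n t : (forall m i, (n <= m)%N -> (0 < i < r m)%N -> s m i = t) ->
  forall j, V (j + (size (v n) + t))%N = V j.
Proof.
move=> st; set P := v n ++ nseq t true.
have szP : size P = (size (v n) + t)%N by rewrite size_cat size_nseq.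
have vP m : (n <= m)%N -> exists q, v m = flatten (nseq q P) ++ v n.
  move=> /subnKC <-; elim: (m - n)%N => [|k [q IH]]; first by exists 0%N; rewrite addn0.
  (* Each copy of [v (n + k)] followed by a spacer is the power [q.+1] of [P]; the last copy,
     without spacer, contributes [q]. *)
  exists ((r (n + k)).-1 * q.+1 + q)%N; rewrite addnS /= {2}IH catA nseqD flatten_cat.
  congr ((_ ++ _) ++ _).
  have : forall i, i \in iota 1 (r (n + k)).-1 -> s (n + k) i = t.
    move=> i; rewrite mem_iota => ir; apply: st; first by rewrite leq_addr.
    by have := r_gt1 (n + k); lia.
  rewrite -[X in nseq (X * _)%N _](size_iota 1); elim: (iota 1 _) => [//|i l IHl] /= sil.
  rewrite IHl => [|j jl]; last by apply: sil; rewrite in_cons jl orbT.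
  rewrite sil ?mem_head // IH -[RHS]/(flatten (nseq (q.+1 + size l * q.+1) P)).
  rewrite nseqD flatten_cat; congr (_ ++ _).
  by rewrite -catA -/P -addn1 nseqD flatten_cat /= cats0.
have VP j : V j = nth false P (j %% size P).
  have [|q e] := vP (n + j)%N; first exact: leq_addr.
  have lt := ltn_size_rank1_block (n + j).
  have := @rank1_occurs (n + j) j; rewrite add0n => ->; last by lia.
  have -> : nth false (v (n + j)) j = nth false (v (n + j) ++ nseq t true) j.
    by rewrite nth_cat ifT //; lia.
  have sz : size (v (n + j)) = (q * size P + size (v n))%N.
    by rewrite e size_cat size_flatten /shape map_nseq sumn_nseq mulnC.
  rewrite e -catA -/P -(@nth_flatten_nseq P q.+1); last by rewrite mulSn; lia.
  by rewrite -addn1 nseqD flatten_cat /= cats0.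
by move=> j; rewrite !VP szP modnDr.
Qed.

End Rank1.

Definition gap_rigid (C : nat) (X : subshift) : Prop :=
  exists n, forall p q g g', size p = n -> size q = n ->
    (size g <= C)%N -> (size g' <= C)%N ->
    lang (set_val X) (p ++ g ++ q) -> lang (set_val X) (p ++ g' ++ q) ->
    size g = size g'.

(** Rigidity with a given [n] only involves words of length at most [2 * n + C]. *)
Lemma gap_rigid_open C X : gap_rigid C X ->
  exists n, forall Y, close n X Y -> gap_rigid C Y.
Proof.
move=> [n h]; exists (n + (C + n))%N => Y XY; exists n => p q g g' pn qn gC g'C.
by rewrite -!XY ?size_cat ?pn ?qn; [exact: h|lia..].
Qed.

Lemma shift_equivariant (X : subshift) (Z : set fullshift) (g : fullshift -> fullshift) :
  (forall k z, Z z -> Z (shiftz k z)) ->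
  (forall z, Z z -> g (Defs.shift z) = Defs.shift (g z)) ->
  forall (k : int) z, Z z -> g (shiftz k z) = shiftz k (g z).
Proof.
move=> sZ gs.
have P (n : nat) z : Z z -> g (shiftz n z) = shiftz n (g z).
  move=> Zz; elim: n => [|n IH]; first by rewrite !shiftz0.
  have -> : n.+1%:Z = 1 + n%:Z by lia.
  by rewrite -!shiftzD -IH -/(Defs.shift _) gs //; exact: sZ.
move=> k z Zz; have [n [->|->]] : exists n : nat, k = n%:Z \/ k = - n%:Z by exists `|k|%N; lia.
  exact: P.
have := P n (shiftz (- n%:Z) z) (sZ _ _ Zz).
by rewrite shiftzD subrr shiftz0 => ->; rewrite shiftzD addNr shiftz0.
Qed.

Section Obstruction.
Variables (Y : subshift) (V : nat -> bool).
Hypotheses (minY : minimal (set_val Y))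
  (conjY : Defs.conjugate (set_val Y) (word_closure V)).

(** The inverse conjugacy as a block code of radius [m]; equivariance allows the comparison of
    different positions in different points. *)
Lemma conjugate_code : exists (g : fullshift -> fullshift) (m : nat),
  (forall z, word_closure V z -> set_val Y (g z)) /\
  forall x x' i i', word_closure V x -> word_closure V x' ->
    (forall t : int, (`|t| <= m)%N -> x (i + t) = x' (i' + t)) -> g x i = g x' i'.
Proof.
case: conjY => f [g [[fY gV] [fK gK] [cf cg] fs]].
have [m code] := closed_code (@word_closure_closed V) cg.
exists g, m; split=> [z Vz|x x' i i' Vx Vx' xx']; first exact: gV.
have gs z : word_closure V z -> g (Defs.shift z) = Defs.shift (g z).
  move=> Vz; have Yg : set_val Y (g z) by exact: gV.
  have := fs _ (mem_set Yg); rewrite gK ?(mem_set Vz) // => <-.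
  by apply: fK; apply: mem_set; exact: subshift_shiftz.
have gk := shift_equivariant Y (@word_closure_shiftz V) gs.
have e k z : word_closure V z -> g z k = g (shiftz k z) 0.
  by move=> Vz; rewrite gk // /shiftz add0r.
rewrite e // (e i') //; apply: code; try exact: word_closure_shiftz.
by move=> t tm; rewrite /shiftz addrC xx' // addrC.
Qed.

Lemma conjugate_periodic_isolated H x : (0 < H)%N -> word_closure V x -> periodic H x -> isolated_subshift Y.
Proof.
move=> H0 Vx px; have [g [m [gV code]]] := conjugate_code.
apply: (minimal_periodic_isolated minY H0 (gV x Vx)) => i.
by apply: code => // t _; rewrite -addrA (addrC H%:Z) addrA px.
Qed.

(** The code turns two copies of a block around a spacer [t] into two fixed words around a gap of
    length [m.*2 + t]. Rigidity makes all late spacers equal, so that [V] is periodic. *)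
Lemma rank1_rigid_isolated : rank1_word V -> (forall C, gap_rigid C Y) -> isolated_subshift Y.
Proof.
move=> [r [s [r1 HV]]] rigid.
have recV := rank1_recurrent r1 HV.
have langV w i : occurs V w i -> lang (word_closure V) w.
  by move=> o; apply: occurs_word_closure o recV.
(* Unbounded runs of ones put a fixed point into the closure; otherwise the spacers are bounded. *)
have [ones|] := pselect (forall k, exists i, occurs V (nseq k true) i).
  apply: (@conjugate_periodic_isolated 1 (fun=> true)) => //; apply/word_closureP => i n.
  have [j o] := ones n; exists j => k kn.
  by rewrite o ?size_nseq // nth_nseq kn.
move=> /existsNP[S noS].
have sS m i : (0 < i < r m)%N -> (s m i <= S)%N.
  move=> ir; have [j] := rank1_spacer_occurs HV (leqnn m) ir.
  move=> /occurs_infix o; rewrite leqNgt; apply/negP => Ss; apply: noS.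
  exists (j + size (rank1_block r s m))%N => k; rewrite size_nseq => kS.
  by rewrite o ?size_nseq ?nth_nseq ?kS; [rewrite ifT|]; lia.
have [g [m [gV code]]] := conjugate_code.
have [n' rig] := rigid (m.*2 + S)%N.
(* A word of length [n'] must remain on each side after the code has used [m] letters at both ends
   of the block. *)
pose n := (n' + m.*2)%N; pose h := size (rank1_block r s n).
have hn : (n < h)%N by exact: ltn_size_rank1_block.
pose spacer t := exists2 x, word_closure V x &
  reads x (rank1_block r s n ++ nseq t true ++ rank1_block r s n) 0.
have spE t t' : (t <= S)%N -> (t' <= S)%N -> spacer t -> spacer t' -> t = t'.
  move=> tS t'S [x Vx rx] [x' Vx' rx'].
  have lft y t0 (k : int) : reads y (rank1_block r s n ++ nseq t0 true ++ rank1_block r s n) 0 ->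
      0 <= k < h%:Z -> y k = nth false (rank1_block r s n) (absz k).
    rewrite reads_cat => -[ry _] kh; rewrite -ry; last by rewrite -/h; lia.
    by congr y; lia.
  have rgt y t0 (k : int) : reads y (rank1_block r s n ++ nseq t0 true ++ rank1_block r s n) 0 ->
      0 <= k < h%:Z -> y (h%:Z + t0%:Z + k) = nth false (rank1_block r s n) (absz k).
    rewrite !reads_cat size_nseq => -[_ [_ ry]] kh; rewrite -ry; last by rewrite -/h; lia.
    by congr y; rewrite -/h; lia.
  pose p := window (g x) (h%:Z - m%:Z - n'%:Z) n'.
  pose q := window (g x) (h%:Z + t%:Z + m%:Z) n'.
  have ep : p = window (g x') (h%:Z - m%:Z - n'%:Z) n'.
    apply/eq_in_map => k; rewrite mem_iota => kn; apply: code => // u um.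
    by rewrite (lft x t) // ?(lft x' t') //; rewrite /n in hn; lia.
  have eq : q = window (g x') (h%:Z + t'%:Z + m%:Z) n'.
    apply/eq_in_map => k; rewrite mem_iota => kn; apply: code => // u um.
    rewrite -!(addrA (h%:Z + _)) (rgt x t) // ?(rgt x' t') //; rewrite /n in hn; lia.
  have gapL y t0 : word_closure V y -> lang (set_val Y)
      (window (g y) (h%:Z - m%:Z - n'%:Z) n' ++ window (g y) (h%:Z - m%:Z) (m.*2 + t0)
       ++ window (g y) (h%:Z + t0%:Z + m%:Z) n').
    move=> Vy; apply: (lang_reads (gV y Vy) (i := h%:Z - m%:Z - n'%:Z)).
    rewrite !reads_cat !size_window; split; first exact: reads_window.
    rewrite subrK; split; first exact: reads_window.
    have -> : h%:Z - m%:Z + (m.*2 + t0)%N%:Z = h%:Z + t0%:Z + m%:Z by lia.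
    exact: reads_window.
  have := rig p q _ _ (size_window _ _ _) (size_window _ _ _) _ _ (gapL x t Vx).
  rewrite ep eq => /(_ (window (g x') (h%:Z - m%:Z) (m.*2 + t'))).
  by rewrite !size_window => /(_ _ _ (gapL x' t' Vx')); lia.
have spacerP k i : (n <= k)%N -> (0 < i < r k)%N -> spacer (s k i).
  by move=> nk ik; have [j /langV] := rank1_spacer_occurs HV nk ik.
have st k i : (n <= k)%N -> (0 < i < r k)%N -> s k i = s n 1%N.
  have r1n : (0 < 1 < r n)%N by rewrite r1.
  by move=> nk ik; apply: spE; [exact: sS|exact: sS|exact: spacerP|exact: spacerP].
have pV := rank1_periodic r1 HV st.
have [x Vx _] : lang (word_closure V) [::] by apply: langV (0%N) _ => k.
apply: (@conjugate_periodic_isolated (h + s n 1%N) x) => //; first by lia.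
move=> i; have /word_closureP/(_ i (h + s n 1%N).+1)[j xj] := Vx.
by rewrite xj ?ltnS // pV -(addr0 i) -[0]/(0%N%:Z) xj // addn0.
Qed.
End Obstruction.

(** * Totally transitive subshifts *)

Section TotallyTransitive.
Variable X : subshift.
Hypothesis ttX : Defs.totally_transitive (set_val X).
Local Notation L := (lang (set_val X)).

(** Total transitivity enters through this form: one point reads every word in every residue class
    modulo [p]. *)
Lemma totally_transitive_reads (p : nat) : (0 < p)%N ->
  exists2 x, set_val X x & forall w (r : int), L w ->
    exists k : int, reads x w (p%:Z * k + r).
Proof.
move=> /ttX[x Xx dx]; exists x => // w r /(lang_at r)[y Xy ry].
have /closure_fullshiftP/(_ (`|r| + size w)%N)[_ [k _ <-] yk] := dx y Xy.
exists k; rewrite addrC -reads_shiftz; exact: agree_reads yk _ ry.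
Qed.

Lemma lang_between x u w (i j : int) : set_val X x -> reads x u i -> reads x w j ->
  i + (size u)%:Z <= j -> exists g, L (u ++ g ++ w).
Proof.
move=> Xx ru rw ij; exists (window x (i + (size u)%:Z) (absz (j - (i + (size u)%:Z))%R)).
apply: (lang_reads Xx (i := i)); rewrite !reads_cat size_window.
split=> //; split; first exact: reads_window.
by rewrite gez0_abs ?subr_ge0 // addrC subrK.
Qed.

(* All occurrences of a word containing both [u] and [w] would otherwise lie in
   a bounded region, but such a word occurs in two classes modulo [2 * m] that
   differ by [m]. *)
Lemma lang_irreducible u w : L u -> L w -> exists g, L (u ++ g ++ w).
Proof.
move=> Lu Lw; have [x Xx rx] := totally_transitive_reads (ltn0Sn 0).
have [i ri] := rx u 0 Lu; have [j rj] := rx w 0 Lw.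
rewrite addr0 in ri; rewrite addr0 in rj.
set i' := 1%:Z * i in ri; set j' := 1%:Z * j in rj.
pose a := Num.min i' j'.
have [ai aj] : a <= i' /\ a <= j' by rewrite /a; lia.
pose m := (absz (i' - a)%R + absz (j' - a)%R + size u + size w).+1.
have [y Xy ry] := @totally_transitive_reads (2 * m)%N isT.
have Lz := lang_window a m Xx.
have [k1 r1] := ry _ 0 Lz; have [k2 r2] := ry _ m%:Z Lz.
have sub v (A l : int) : reads y (window x a m) A -> reads x v l -> a <= l ->
    l - a + (size v)%:Z <= m%:Z -> reads y v (A + (l - a)).
  move=> rA rv al lm k kv; have := rA (absz (l - a)%R + k)%N; rewrite size_window nth_mkseq; last by lia.
  have -> : a + (absz (l - a)%R + k)%N%:Z = l + k%:Z by lia.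
  have -> : A + (absz (l - a)%R + k)%N%:Z = A + (l - a) + k%:Z by lia.
  by rewrite rv // => ->; lia.
have uA A : reads y (window x a m) A -> reads y u (A + (i' - a)).
  by move=> rA; apply: sub rA ri ai _; lia.
have wA A : reads y (window x a m) A -> reads y w (A + (j' - a)).
  by move=> rA; apply: sub rA rj aj _; lia.
have [k12|k12] := lerP k1 k2.
  by apply: (lang_between Xy (uA _ r1) (wA _ r2)); rewrite addr0; nia.
by apply: (lang_between Xy (uA _ r2) (wA _ r1)); rewrite addr0; nia.
Qed.

(** * Loops at a word *)

Section Loops.
Variables (n : nat) (u : seq bool).
Hypotheses (n_gt0 : (0 < n)%N) (un : size u = n) (Lu : L u).

Definition locally (z : seq bool) := forall i, L (take n (drop i z)).

(** The label of a closed walk at [u] in the graph whose vertices are the words of length [n] of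
    [X], joined when they overlap. *)
Definition loop (l : seq bool) := locally (u ++ l) /\ exists c, u ++ l = c ++ u.

Lemma lang_locally z : L z -> locally z.
Proof.
move=> Lz i; apply: (@lang_infix X (take i z) _ (drop n (drop i z))).
by rewrite !cat_take_drop.
Qed.

Lemma loop_nil : loop [::].
Proof. by split; [rewrite cats0; exact: lang_locally|exists [::]; rewrite cats0]. Qed.

Lemma lang_loop l c : L (u ++ l) -> u ++ l = c ++ u -> loop l.
Proof. by move=> Ll e; split; [exact: lang_locally|exists c]. Qed.

Lemma loop_cat l l' : loop l -> loop l' -> loop (l ++ l').
Proof.
move=> [h [c e]] [h' [c' e']]; split; last first.
  by exists (c ++ c'); rewrite catA e -catA e' catA.
(* A window that starts no later than the end of [c] lies in [u ++ l]; a later one lies in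
   [u ++ l'], since [u ++ l = c ++ u]. *)
move=> i; rewrite catA; have [ic|ci] := leqP i (size c).
  have le : (i + n <= size (u ++ l))%N by rewrite e size_cat un leq_add2r.
  rewrite drop_cat; case: ltnP => il; first by rewrite takel_cat // size_drop; lia.
  lia.
by rewrite e -catA drop_cat ltnNge ltnW //; exact: h'.
Qed.

Lemma loop_flatten ls : (forall l, l \in ls -> loop l) -> loop (flatten ls).
Proof.
elim: ls => [_|l ls IH h]; first exact: loop_nil.
apply: loop_cat; first by apply: h; exact: mem_head.
by apply: IH => l' l'ls; apply: h; rewrite in_cons l'ls orbT.
Qed.

Lemma loop_nseq k l : loop l -> loop (flatten (nseq k l)).
Proof. by move=> hl; apply: loop_flatten => l' /nseqP[->]. Qed.

Lemma loop_to z : L (u ++ z) -> exists2 l, loop (z ++ l) & exists g, l = g ++ u.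
Proof.
move=> /lang_irreducible/(_ Lu)[g Lg]; exists (g ++ u); last by exists g.
by apply: (@lang_loop _ (u ++ z ++ g)); rewrite -!catA // in Lg *.
Qed.

Lemma loop_through w : L w -> exists2 l, loop l & exists c d, u ++ l = c ++ w ++ d.
Proof.
move=> Lw; have [g Lg] := lang_irreducible Lu Lw.
have [l hl _] := loop_to Lg; exists ((g ++ w) ++ l) => //.
by exists (u ++ g), l; rewrite -!catA.
Qed.

Lemma loop_covering (ws : seq (seq bool)) : (forall w, w \in ws -> L w) ->
  exists2 l, loop l & forall w, w \in ws -> exists c d, u ++ l = c ++ w ++ d.
Proof.
elim: ws => [_|w ws IH h]; first by exists [::] => //; exact: loop_nil.
have [|l hl lc] := IH; first by move=> w' ww'; apply: h; rewrite in_cons ww' orbT.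
have [|l' hl' [c [d e]]] := @loop_through w; first by apply: h; exact: mem_head.
exists (l ++ l') => [|w']; first exact: loop_cat.
rewrite in_cons => /orP[/eqP->|/lc[c' [d' e']]].
  by have [_ [c0 e0]] := hl; exists (c0 ++ c), d; rewrite catA e0 -catA e catA.
by exists c', (d' ++ l'); rewrite catA e' -!catA.
Qed.

Lemma loop_covers : exists2 l, loop l &
  forall w, (size w <= n)%N -> L w -> exists c d, u ++ l = c ++ w ++ d.
Proof.
pose ws := [seq val t | t <- enum {: n.-tuple bool} & `[< L (val t) >]].
have [|l hl lc] := @loop_covering ws.
  by move=> w /mapP[t]; rewrite mem_filter => /andP[/asboolP Lt _] ->.
exists l => // w wn Lw.
have [v [v' [/size0nil-> v'n Lv]]] := @lang_extend X 0 (n - size w) _ Lw.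
have wv : size (w ++ v') == n by rewrite size_cat v'n subnKC.
have [|c [d e]] := lc (Tuple wv).
  by apply/mapP; exists (Tuple wv) => //; rewrite mem_filter mem_enum andbT; exact/asboolP.
by exists c, (v' ++ d); rewrite e /= -catA.
Qed.

Lemma loop_reads x (i j : int) : set_val X x -> reads x u i -> reads x u j -> i <= j ->
  exists2 l, loop l & size l = absz (j - i)%R.
Proof.
move=> Xx ri rj ij; exists (window x (i + n%:Z) (absz (j - i)%R)); last exact: size_window.
have e (v : int) : reads x u v -> u = window x v n.
  move=> rv; apply: (@eq_from_nth _ false); first by rewrite size_window.
  by move=> k ku; rewrite nth_mkseq -?un // rv.
have wD a s t : window x a s ++ window x (a + s%:Z) t = window x a (s + t).
  apply: (@eq_from_nth _ false); first by rewrite size_cat !size_window.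
  move=> k; rewrite size_cat !size_window => kst; rewrite nth_cat size_window.
  by case: ltnP => ks; rewrite !nth_mkseq //; [congr x|]; lia.
apply: (@lang_loop _ (window x i (absz (j - i)%R))); first by rewrite (e _ ri) wD; exact: lang_window.
have ej : window x j n = window x (i + (absz (j - i)%R)%:Z) n by congr window; lia.
by rewrite {1}(e _ ri) (e _ rj) ej !wD addnC.
Qed.

(* With [p] the length of a loop, a point with dense orbit under the [p]-th power
   of the shift has [u] at a multiple of [p] and at one plus a multiple of [p]. *)
Lemma loop_consecutive : exists t l l',
  [/\ (0 < t)%N, loop l /\ size l = t & loop l' /\ size l' = t.+1].
Proof.
have [l0 hl0 [g l0g]] : exists2 l, loop l & exists g, l = g ++ u.
  by apply: (@loop_to [::]); rewrite cats0.
have p0 : (0 < size l0)%N by rewrite l0g size_cat un; lia.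
have [x Xx rx] := totally_transitive_reads p0.
have [k1 r1] := rx u 0 Lu; have [k2 r2] := rx u 1 Lu; rewrite addr0 in r1.
(* Depending on the order of the two occurrences, the loop between them is one longer or one shorter
   than a multiple of [size l0]. Appending [l0] keeps [t] positive. *)
have [lt|ge] := ltrP ((size l0)%:Z * k1) ((size l0)%:Z * k2 + 1).
  have [l hl sl] := loop_reads Xx r1 r2 (ltW lt).
  have k12 : k1 <= k2 by nia.
  exists ((absz (k2 - k1)%R).+1 * size l0)%N, (flatten (nseq (absz (k2 - k1)%R).+1 l0)), (l ++ l0).
  split; [by lia| |]; split; [exact: loop_nseq|exact: size_flatten_nseq|exact: loop_cat|].
  rewrite size_cat sl; nia.
have [l hl sl] := loop_reads Xx r2 r1 ge.
have k12 : k2 < k1 by nia.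
exists (((absz (k1 - k2)%R).+1 * size l0).-1)%N, (l ++ l0), (flatten (nseq (absz (k1 - k2)%R).+1 l0)).
split; [by nia| |]; split; [exact: loop_cat| |exact: loop_nseq|].
  rewrite size_cat sl; nia.
rewrite size_flatten_nseq; nia.
Qed.

Lemma loop_sizes : exists T, forall m, (T <= m)%N -> exists2 l, loop l & size l = m.
Proof.
have [t [l [l' [t0 [hl sl] [hl' sl']]]]] := loop_consecutive.
exists (t * t)%N => m tm.
have qt : (t <= m %/ t)%N by rewrite leq_divRL.
have rt : (m %% t < t)%N by rewrite ltn_mod.
(* From [t * t <= m], the quotient is at least the remainder, so [m %% t] of the loops of length [t]
   can be exchanged for loops of length [t.+1]. *)
exists (flatten (nseq (m %/ t - m %% t) l) ++ flatten (nseq (m %% t) l')).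
  by apply: loop_cat; exact: loop_nseq.
have rq : (m %% t * t <= m %/ t * t)%N by rewrite leq_mul2r; lia.
by rewrite size_cat !size_flatten_nseq sl sl' mulnBl mulnS; have := divn_eq m t; lia.
Qed.

End Loops.

(** Otherwise words of length [n] determine the future of a point, by [det]. A return to [u] makes
    the future periodic, irreducibility spreads this period to all of [X], and [X] is minimal and
    periodic, hence isolated. *)
Lemma right_special n : (0 < n)%N -> ~ isolated_subshift X ->
  exists u, [/\ size u = n, L (rcons u false) & L (rcons u true)].
Proof.
move=> n0 nX; apply: contrapT => noRS; apply: nX.
have det x y (i j : int) : set_val X x -> set_val X y -> window x i n = window y j n ->
    forall k : nat, x (i + k%:Z) = y (j + k%:Z).
  move=> Xx Xy e0 k.
  have step (a b : int) : window x a n = window y b n -> x (a + n%:Z) = y (b + n%:Z).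
    move=> e; have := lang_window a n.+1 Xx; have := lang_window b n.+1 Xy.
    rewrite /window !mkseqS -/(window x a n) -/(window y b n) -e.
    case: (x _); case: (y _) => // h1 h2; exfalso; apply: noRS;
      exists (window x a n); by rewrite size_window.
  suff : window x (i + k%:Z) n = window y (j + k%:Z) n.
    by move/(congr1 (fun s => nth false s 0)); rewrite !nth_mkseq // !addr0.
  elim: k => [|k IH]; first by rewrite !addr0.
  apply: (@eq_from_nth _ false) => [|l]; rewrite !size_window // => ln.
  rewrite !nth_mkseq //; have [l1|l1] := ltnP l.+1 n.
    move/(congr1 (fun s => nth false s l.+1)): IH; rewrite !nth_mkseq //.
    have -> : i + k%:Z + l.+1%:Z = i + k.+1%:Z + l%:Z by lia.
    by have -> : j + k%:Z + l.+1%:Z = j + k.+1%:Z + l%:Z by lia.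
  have := step _ _ IH.
  have -> : i + k%:Z + n%:Z = i + k.+1%:Z + l%:Z by lia.
  by have -> : j + k%:Z + n%:Z = j + k.+1%:Z + l%:Z by lia.
have [x0 Xx0 _] := ttX (ltn0Sn 0).
have readsE x u i : size u = n -> reads x u i -> window x i n = u.
  move=> un ru; apply: (@eq_from_nth _ false); rewrite size_window // => k kn.
  by rewrite nth_mkseq // ru // un.
pose u := window x0 0 n; have Lu : L u by exact: lang_window.
have un : size u = n by exact: size_window.
have [g [y Xy]] := lang_irreducible Lu Lu.
rewrite !reads_cat add0r => -[ry0 [_ ryH]].
pose H := (n + size g)%N.
have {}ryH : reads y u H%:Z by rewrite /H PoszD -{1}un.
have yper (k : nat) : y (k%:Z + H%:Z) = y k%:Z.
  have := det y y H%:Z 0 Xy Xy; rewrite !(readsE _ u) // => /(_ erefl k).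
  by rewrite add0r addrC.
have perL w : L w -> size w = H.+1 -> nth false w H = nth false w 0.
  move=> Lw wH; have [g' [z Xz]] := lang_irreducible Lu Lw.
  rewrite !reads_cat add0r => -[rz0 [_ rzw]].
  have zy k : z (0 + k%:Z) = y (0 + k%:Z) by apply: det => //; rewrite !(readsE _ u).
  rewrite -!rzw ?wH // -!addrA -!PoszD -[X in z X]add0r -[X in _ = z X]add0r !zy.
  by rewrite !add0r addn0 addnA PoszD yper.
have perX x : set_val X x -> periodic H x.
  move=> Xx i; have := perL _ (lang_window i H.+1 Xx) (size_window _ _ _).
  by rewrite !nth_mkseq // addr0.
apply: (@minimal_periodic_isolated X H y) => //; last 2 first.
- by rewrite /H; lia.
- exact: perX.
move=> x Xx x' Xx'; apply/closure_fullshiftP => N.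
have [g' [z Xz]] := lang_irreducible (lang_window 0 n Xx) (lang_window (- N%:Z) N.*2.+1 Xx').
rewrite !reads_cat add0r !size_window => -[rz0 [_ rzw]].
have zx k : z (0 + k%:Z) = x (0 + k%:Z).
  by apply: det => //; rewrite (readsE _ (window x 0 n)) ?size_window.
exists (shiftz (1%:Z * (n + size g' + N)%N%:Z) x); first by eexists.
move=> i iN; have := rzw (absz (i + N%:Z)%R); rewrite size_window nth_mkseq; last by lia.
have -> : - N%:Z + (absz (i + N%:Z)%R)%:Z = i by lia.
move=> <-; last by lia.
have -> : n%:Z + (size g')%:Z + (absz (i + N%:Z)%R)%:Z = 0 + (n + size g' + absz (i + N%:Z)%R)%N%:Z by lia.
by rewrite zx /shiftz; congr x; lia.
Qed.

End TotallyTransitive.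

(** An isolated [X] is of finite type, so closing up [w ++ g] gives a periodic point [z] in it.
    Under the [H]-th power of the shift the orbit of [z] is a single point, yet it is dense. *)
Lemma totally_minimal_isolated (X : subshift) :
  (forall p x, (0 < p)%N -> set_val X x ->
     set_val X `<=` closure (shift_orbit p x)) ->
  isolated_subshift X -> forall x y, set_val X x -> set_val X y -> x = y.
Proof.
move=> tmX [n0 aX] x y Xx Xy.
have ttX : Defs.totally_transitive (set_val X) by move=> p p0; exists x => //; exact: tmX.
pose n := n0.+1; pose w := window x 0 n.
have [g Lg] := lang_irreducible ttX (lang_window 0 n Xx) (lang_window 0 n Xx).
rewrite -/w in Lg; pose H := (n + size g)%N.
have wn : size w = n by exact: size_window.
have wgH : size (w ++ g) = H by rewrite size_cat wn.
have H0 : (0 < H)%N by rewrite /H /n; lia.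
pose z : fullshift := fun i => nth false (w ++ g) (absz (i %% H%:Z)%Z).
have pz : periodic H z by move=> i; rewrite /z modzDr.
have Xz : set_val X z.
  have <- : sft n (lang (set_val X)) = X.
    by apply: aX; apply: (@close_le n0 n); [exact: leqnSn|exact: close_sft].
  move=> i; set o := absz (i %% H%:Z)%Z.
  have oH : (o < H)%N by rewrite -ltz_nat /o gez0_abs ?modz_ge0 ?ltz_mod //; lia.
  have -> : window z i n = take n (drop o (w ++ g ++ w)).
    apply: (@eq_from_nth _ false) => [|k].
      by rewrite size_window size_takel // size_drop !size_cat wn -/H; rewrite /H in oH *; lia.
    rewrite size_window => kn; rewrite nth_mkseq // nth_take // nth_drop.
    have zio : z (i + k%:Z) = nth false (w ++ g) ((o + k) %% H)%N.
      have eo : (i %% H%:Z)%Z = o%:Z by rewrite /o gez0_abs // modz_ge0 //; lia.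
      by rewrite /z -modzDml eo -PoszD modz_nat absz_nat.
    rewrite zio catA [RHS]nth_cat wgH; case: ltnP => okH; first by rewrite modn_small.
    have -> : ((o + k) %% H = o + k - H)%N.
      by rewrite -{1}(subnK okH) modnDr modn_small //; rewrite /H in oH okH *; lia.
    by rewrite nth_cat ifT // wn; rewrite /H in oH *; lia.
  apply: (@lang_infix X (take o (w ++ g ++ w)) _ (drop n (drop o (w ++ g ++ w)))).
  by rewrite !cat_take_drop.
suff sing t : set_val X t -> t = z by rewrite (sing x) // (sing y).
move=> Xt; apply/funext => i.
have /closure_fullshiftP/(_ `|i|%N)[_ [k _ <-] tz] := tmX H z H0 Xz t Xt.
by rewrite tz // /shiftz mulrC periodicM.
Qed.

(** * Chacon subshifts *)

Section ChaconSubshift.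
Variables (blk : bool -> seq bool) (alpha D : nat).
Hypotheses (szblk : forall x, size (blk x) = (alpha + x * D)%N) (alpha_gt0 : (0 < alpha)%N)
  (coD : coprime alpha D) (co3 : coprime 3 D).
Local Notation V := (conc blk chacon).
Local Notation Y := (word_subshift V).

Lemma chacon_syndetic p w i0 : (0 < p)%N -> occurs V w i0 ->
  exists L, forall i, exists2 j, (j < L)%N & (p %| j)%N /\ occurs V w (i + j).
Proof. exact: (syndetic_occurrences szblk). Qed.

Lemma chacon_lang w i : occurs V w i -> lang (set_val Y) w.
Proof.
move=> o; apply: (occurs_word_closure o) => {o i}w i o n.
have [L synL] := chacon_syndetic (ltn0Sn 0) o; have [j _ [_ oj]] := synL n.
by exists (n + j)%N => //; rewrite leq_addr.
Qed.

Lemma chacon_totally_minimal p x : (0 < p)%N -> set_val Y x ->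
  set_val Y `<=` closure (shift_orbit p x).
Proof. exact: (syndetic_dense chacon_syndetic). Qed.

Lemma chacon_minimal : Defs.minimal (set_val Y).
Proof. by move=> x; exact: chacon_totally_minimal. Qed.

Lemma chacon_totally_transitive : Defs.totally_transitive (set_val Y).
Proof.
have [x Yx _] : lang (set_val Y) [::] by apply: (@chacon_lang _ 0%N) => k.
by move=> p p0; exists x => //; exact: chacon_totally_minimal.
Qed.

Lemma chacon_not_isolated i j : V i -> ~~ V j -> ~ isolated_subshift Y.
Proof.
move=> Vi Vj aY.
have rd b k : V k = b -> lang (set_val Y) [:: b].
  by move=> Vk; apply: (@chacon_lang _ k) => -[|//] _; rewrite addn0.
have [x Yx rx] := rd _ _ Vi; have [y Yy ry] := rd _ _ (negbTE Vj).
have xy := totally_minimal_isolated chacon_totally_minimal aY Yx Yy.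
by have := rx 0%N isT; rewrite xy (ry 0%N isT).
Qed.

End ChaconSubshift.

(* [v_1 = 0 1^(alpha - 2) 0] and [v_1 1^D]: with these blocks the towers are the
   words [v_n] of a rank-1 sequence with all spacers in {0, D} from level 1 on. *)
Definition rank1_start (alpha D : nat) (x : bool) : seq bool :=
  false :: nseq (alpha - 2) true ++ false :: nseq (x * D) true.

Section RankOneChacon.
Variables (alpha D : nat).
Hypotheses (D_gt0 : (0 < D)%N) (Da : (D + 2 < alpha)%N).
Local Notation blk := (rank1_start alpha D).

Lemma size_rank1_start x : size (blk x) = (alpha + x * D)%N.
Proof. by rewrite /= size_cat /= !size_nseq; lia. Qed.

Lemma rank1_word_chacon : rank1_word (conc blk chacon).
Proof.
pose r n := if n is 0 then 2%N else 3%N.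
pose s n i := if n is 0 then (alpha - 2)%N else ((i == 2%N) * D)%N.
have e n : rank1_block r s n.+1 = tower blk n false /\
           tower blk n true = tower blk n false ++ nseq D true.
  elim: n => [|n [IH1 IH2]].
    split; first by rewrite /= cats0.
    by rewrite /= /rank1_start mul1n -catA.
  split; last by rewrite /= {2}IH2 !catA.
  have -> : rank1_block r s n.+2 = flatten [seq rank1_block r s n.+1 ++ nseq (s n.+1 i) true
     | i <- [:: 1; 2]%N] ++ rank1_block r s n.+1 by [].
  by rewrite IH1 /= mul1n !cats0 IH2 !catA.
exists r, s; split; first by case.
case=> [|n].
  by rewrite /= /mkseq /= /conc.
rewrite (e n).1; apply: (@eq_from_nth _ false); rewrite size_mkseq // => k kn.
by rewrite nth_mkseq //; apply: (conc_U size_rank1_start) => //; lia.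
Qed.

Lemma nth_rank1_start x k : (k < size (blk x))%N ->
  nth false (blk x) k = (k != 0%N) && (k != alpha.-1).
Proof.
rewrite size_rank1_start; case: k => [//|k] kn; rewrite /= nth_cat size_nseq nth_nseq.
case: ltnP => ka; first by apply/esym; lia.
case e: (k - (alpha - 2))%N => [|m] /=; first by apply/esym; lia.
by rewrite /= nth_nseq ifT; lia.
Qed.

(** A cut is a zero followed by at least [alpha - 2] ones: the other zero of a block is followed by
    at most [D] ones, and [D < alpha - 2]. *)
Lemma rank1_recognizable : recognizable alpha blk chacon.
Proof.
set V := conc blk chacon.
have blk_gt0 x : (0 < size (blk x))%N by [].
have cutE j : is_cut blk chacon j <-> V j = false /\ forall t, (0 < t <= alpha - 2)%N -> V (j + t)%N.
  split=> [[n ->]|[Vj run]].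
    have E k : (k < alpha)%N -> V (cutpos blk chacon n + k)%N = (k != 0%N) && (k != alpha.-1).
      by move=> ka; rewrite /V concE ?nth_rank1_start // size_rank1_start; lia.
    split; first by rewrite -[cutpos _ _ _]addn0 E //; lia.
    by move=> t ta; rewrite E; lia.
  have [n [[|k] [e kn]]] := locate chacon blk_gt0 j; first by exists n; lia.
  exfalso; have := Vj; rewrite e /V concE // nth_rank1_start // => ka.
  have {}ka : k.+1 = alpha.-1 by lia.
  have nx : V (cutpos blk chacon n.+1) = false.
    by rewrite -[cutpos _ _ _]addn0 /V concE.
  have ej : cutpos blk chacon n.+1 = (j + (chacon n * D).+1)%N.
    by rewrite cutposS size_rank1_start e; lia.
  have := run (chacon n * D).+1; rewrite -ej nx => h; suff : false by [].
  by apply: h; case: (chacon n); lia.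
move=> i j ri rj ag /cutE[Vi run]; apply/cutE.
have E t : (t <= alpha)%N -> V (i + t)%N = V (j + t)%N.
  move=> ta; have := ag (alpha + t)%N.
  have -> : (i - alpha + (alpha + t) = i + t)%N by lia.
  have -> : (j - alpha + (alpha + t) = j + t)%N by lia.
  by apply; lia.
split; first by have := E 0%N isT; rewrite !addn0 => <-.
by move=> t ta; rewrite -E ?run //; lia.
Qed.

End RankOneChacon.

Lemma totally_transitive_example :
  exists X : subshift, ~ isolated_subshift X /\ Defs.totally_transitive (set_val X).
Proof.
have sz := @size_rank1_start 5%N 1%N isT isT.
exists (word_subshift (conc (rank1_start 5 1) chacon)); split.
  exact: (@chacon_not_isolated _ 5%N 1%N sz isT isT isT 1%N 0%N).
exact: (@chacon_totally_transitive _ 5%N 1%N sz isT isT isT).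
Qed.

(** * Approximation by Chacon concatenations of loops *)

Lemma occurs_prefix blk z m : (forall x, (0 < size (blk x))%N) ->
  occurs (conc blk z) (flatten [seq blk (z j) | j <- iota 0 m]) 0.
Proof.
move=> blk0; elim: m => [|m IH] k //; rewrite add0n.
rewrite -(addn1 m) iotaD map_cat flatten_cat /= cats0 (add0n m) nth_cat size_cat.
move=> kn; case: ifPn => [km|]; first by have := IH k km; rewrite add0n.
rewrite -leqNgt => km; rewrite -{1}(subnKC km) -(cutpos_size blk z m) concE //.
by rewrite cutpos_size; lia.
Qed.

Lemma occurs_extract V P w j : occurs V P 0 -> (j + size w <= size P)%N ->
  occurs V w j -> w = take (size w) (drop j P).
Proof.
move=> oP jP ow; apply: (@eq_from_nth _ false) => [|k kw].
  by rewrite size_takel // size_drop; lia.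
by rewrite nth_take // nth_drop -ow // -(oP (j + k)%N) //; lia.
Qed.

Lemma approximation (X : subshift) n C : Defs.totally_transitive (set_val X) -> ~ isolated_subshift X ->
  exists Y, [/\ close n X Y, ~ isolated_subshift Y, Defs.totally_transitive (set_val Y),
    minimal_rank1 Y & gap_rigid C Y].
Proof.
move=> ttX nX; wlog n0 : n / (0 < n)%N.
  move=> /(_ n.+1 isT)[Y [XY ? ? ? ?]]; exists Y; split=> //.
  by apply: (@close_le n n.+1).
have [u [un Lu0 Lu1]] := right_special ttX n0 nX.
have Lu : lang (set_val X) u by move: Lu0; rewrite -cats1 => /lang_prefix.
rewrite -!cats1 in Lu0 Lu1.
have [a' la [ga ea]] := loop_to ttX n Lu Lu0; have [b' lb [gb eb]] := loop_to ttX n Lu Lu1.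
(* These loops leave [u] by different letters. Blocks start with [b] and end in a power of [a], so
   each new block breaks the period at its first letter. *)
pose a := [:: false] ++ a'; pose b := [:: true] ++ b'.
have [e le ecov] := loop_covers ttX n0 un Lu.
have [T large] := loop_sizes ttX n0 un Lu.
(* A power of 2 exceeding [C]: it is coprime to 3 and to any odd [alpha], as recurrence of the
   Chacon concatenation requires. *)
pose D := (2 ^ C)%N; have CD : (C < D)%N by exact: ltn_expl.
(* [d0] makes [alpha] odd, hence coprime to [D]. *)
pose d0 := (~~ odd (size b + (size e + T)) : nat).
have [e' le' se'] := large (T + d0)%N (leq_addr _ _).
pose c := e ++ e'; have lc : loop X n u c by exact: loop_cat.
have sc : size c = (size e + T + d0)%N by rewrite size_cat se' addnA.
have [d ld sd] : exists2 d, loop X n u d & size d = (size c + D)%N.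
  by apply: large; rewrite sc; lia.
(* [K] makes the run outlast the core and [alpha] exceed [4 * D + C]. It is even, so the parity of
   [alpha] is that of the short core. *)
pose q := size a; pose K := (2 * (size b + size c + 5 * D + C + 2))%N.
pose core x := b ++ (if x then d else c).
pose blk x := core x ++ flatten (nseq K a).
pose h x := size (core x).
have hE x : h x = (size b + size c + x * D)%N.
  by rewrite /h size_cat; case: x; rewrite ?sd; lia.
have q0 : (0 < q)%N by [].
have szflat : size (flatten (nseq K a)) = (K * q)%N by exact: size_flatten_nseq.
pose M := (K.-1 * q)%N.
have KqE : (K * q = q + M)%N.
  by rewrite -mulSn prednK // /K; lia.
have szM x : size (blk x) = (h x + q + M)%N by rewrite size_cat szflat -/(h x) KqE addnA.
have hq x : (h x + q <= M)%N.
  rewrite /M; have -> : K.-1 = (K - 2).+1 by rewrite /K; lia.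
  rewrite mulSn addnC leq_add2l hE; apply: leq_trans (leq_pmulr _ q0).
  by rewrite /K; case: x; lia.
pose alpha := size (blk false).
have sz x : size (blk x) = (alpha + x * D)%N by rewrite /alpha !szM !hE; lia.
have Ka : (K <= alpha)%N.
  by rewrite /alpha szM -addnA -KqE; apply: leq_trans (leq_addl _ _); exact: leq_pmulr.
have bigalpha : (4 * D + C < alpha)%N by apply: leq_trans Ka; rewrite /K; lia.
have D0 : (0 < D)%N by rewrite /D expn_gt0.
have alpha0 : (0 < alpha)%N by lia.
have odd_alpha : odd alpha.
  rewrite /alpha szM -addnA -KqE hE sc mul0n addn0 oddD oddM /K oddM andFb addbF.
  by rewrite addnA oddD /d0; case: (odd _).
have M0 : (M %% q = 0)%N by exact: modnMl.
clearbody M.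
have coD : coprime alpha D by rewrite coprimeXr // coprimen2.
have co3 : coprime 3 D by rewrite coprimeXr.
have hd x : nth false (blk x) 0 = true by [].
have nthB x k : (h x <= k < h x + K * q)%N -> nth false (blk x) k = nth false a ((k - h x) %% q).
  move=> /andP[k1 k2]; rewrite nth_cat -/(h x) ltnNge k1 nth_flatten_nseq //.
  by rewrite ltn_subLR.
have tl x : nth false (blk x) (size (blk x) - q) = false.
  have -> : (size (blk x) - q = h x + M)%N by rewrite szM addnAC addnK.
  by rewrite nthB; [rewrite addKn M0|rewrite KqE; lia].
have per x k : (h x + q <= k < size (blk x))%N ->
    nth false (blk x) k = nth false (blk x) (k - q).
  rewrite szM -addnA -KqE => /andP[k1 k2]; have kq : (q <= k - h x)%N by lia.
  by rewrite !nthB; [rewrite -{1}(subnK kq) modnDr subnAC|lia..].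
have rec : recognizable (M + q) blk chacon by exact: marked_recognizable q0 hq szM hd tl per.
have szblk' x : size (rank1_start alpha D x) = size (blk x).
  by rewrite sz size_rank1_start //; lia.
have s01 : (0 < size (blk false) < size (blk true))%N by rewrite !sz; lia.
have s01' : (0 < size (rank1_start alpha D false) < size (rank1_start alpha D true))%N.
  by rewrite !szblk'.
have Da : (D + 2 < alpha)%N by lia.
(* Both concatenations follow [chacon] with the same block lengths and have recognizable cuts, so
   each is a block factor of the other. *)
have fac1 := recognizable_factor (fun x => esym (szblk' x)) s01 rec.
have fac2 := recognizable_factor szblk' s01' (@rank1_recognizable alpha D D0 Da).
pose V := conc blk chacon; pose Y := word_subshift V.
have blk0 x : (0 < size (blk x))%N by rewrite sz; lia.
have lblk x : loop X n u (blk x).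
  apply: (loop_cat n0 un); last exact: loop_nseq.
  by apply: (loop_cat n0 un) => //; case: x.
have occ0 : occurs V (blk false) 0.
  by have := @occurs_prefix blk chacon 1 blk0; rewrite /= cats0.
exists Y; split.
- move=> w wn; split=> Lw.
    (* [blk false] contains [e] right after [b], which ends in [u], so every short word of [X]
       occurs in it. *)
    have [w1 [w2 e12]] := ecov w wn Lw.
    apply: (@lang_infix Y ([:: true] ++ gb ++ w1) w (w2 ++ e' ++ flatten (nseq K a))).
    apply: (chacon_lang sz alpha0 coD co3 (i := 0)).
    rewrite (_ : _ ++ _ = blk false) //.
    by rewrite /blk /core /c /b eb -!catA; congr (_ ++ (_ ++ _)); rewrite !catA e12 -!catA.
  (* Conversely, a prefix of [V] is a product of loops, whose short words all belong to the language
     of [X]. *)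
  have [j oj] := lang_word_closure Lw.
  have oP := @occurs_prefix blk chacon (j + size w) blk0.
  set P := flatten _ in oP.
  have jP : (j + size w <= size P)%N by rewrite /P -cutpos_size; exact: leq_cutpos.
  have lP : loop X n u P.
    by apply: (loop_flatten n0 un Lu) => l /mapP[x _ ->].
  have [/(_ (size u + j)%N) LP _] := lP.
  rewrite drop_cat ltnNge leq_addr /= addKn in LP.
  rewrite (occurs_extract oP jP oj) -(subnKC wn) takeD in LP *.
  exact: lang_prefix LP.
- apply: (@chacon_not_isolated _ _ _ sz alpha0 coD co3 0%N (alpha - q)%N).
    by rewrite -/V -[V _]/(V (0 + 0)%N) occ0.
  by rewrite -/V -[V _]/(V (0 + (alpha - q))%N) occ0 ?tl //; lia.
- exact: chacon_totally_transitive sz alpha0 coD co3.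
- split; first exact: chacon_minimal sz alpha0 coD co3.
  exists (conc (rank1_start alpha D) chacon); first exact: rank1_word_chacon.
  exact: block_factor_conjugate fac1 fac2.
exists (M + q + alpha + D)%N => p r g g' pn rn gC g'C.
move=> /lang_word_closure[i oi] /lang_word_closure[j oj].
by apply: (connecting_gap q0 hq szM hd tl per sz CD bigalpha _ _ gC g'C oi oj); rewrite ?pn ?rn.
Qed.

(** * Genericity *)

(** The zeros on the negative side put the fixed point of zeros into the orbit closure; on the other
    side the zeros sit at the powers of two, with growing distances. *)
Definition sparse_point : fullshift :=
  fun i => `[< 0 <= i /\ forall k, i <> (2 ^ k)%N%:Z >].

Lemma sparse_pointF i : sparse_point i = false -> 0 <= i -> exists k, i = (2 ^ k)%N%:Z.
Proof.
move=> /asboolPn h i0; apply: contrapT => nk; apply: h; split=> // k e.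
by apply: nk; exists k.
Qed.

Lemma sparse_point_neg i : i < 0 -> sparse_point i = false.
Proof. by move=> i0; apply/asboolPn => -[]; lia. Qed.

Lemma sparse_point_pow k : sparse_point (2 ^ k)%N%:Z = false.
Proof. by apply/asboolPn => -[_ /(_ k)]. Qed.

Lemma sparse_point_near (k M : nat) (t : int) : (M < 2 ^ k)%N -> (`|t| <= M)%N ->
  sparse_point ((2 ^ k.+1)%N%:Z + t) = (t != 0).
Proof.
move=> Mk tM; have [->|t0] := eqVneq t 0; first by rewrite addr0 sparse_point_pow.
apply/asboolP; have e : (2 ^ k.+1 = 2 ^ k + 2 ^ k)%N by rewrite expnS; lia.
split=> [|l el]; first by lia.
have [lk|kl|lk] := ltngtP l k.+1.
- have : (2 ^ l <= 2 ^ k)%N by rewrite leq_exp2l.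
  lia.
- have : (2 ^ k.+2 <= 2 ^ l)%N by rewrite leq_exp2l.
  rewrite (expnS 2 k.+1); lia.
by rewrite lk in el; lia.
Qed.

Definition sparse_set : set fullshift := closure (shift_orbit 1 sparse_point).

Lemma sparse_closed : closed sparse_set. Proof. exact: closed_closure. Qed.

Lemma sparse_shiftz k x : sparse_set x -> sparse_set (shiftz k x).
Proof.
move=> /closure_fullshiftP cx; apply/closure_fullshiftP => N.
have [_ [l _ <-] xl] := cx (N + `|k|)%N.
exists (shiftz (1%:Z * (k + l)) sparse_point); first by exists (k + l).
move=> i iN; rewrite /shiftz xl; last by lia.
by rewrite /shiftz; congr sparse_point; lia.
Qed.

Definition sparse : subshift := mk_subshift sparse_closed sparse_shiftz.

Lemma sparse_lang w : lang (set_val sparse) w <-> exists i, reads sparse_point w i.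
Proof.
split=> [[x /closure_fullshiftP/(_ (size w))[_ [l _ <-] xl] r]|[i r]].
  exists l; have : reads (shiftz (1%:Z * l) sparse_point) w 0.
    by apply: agree_reads xl _ r; rewrite absz0.
  by rewrite reads_shiftz add0r mul1r.
apply: (lang_reads (X := sparse) _ r); apply: subset_closure.
by exists 0 => //; rewrite mulr0 shiftz0.
Qed.

Lemma sparse_transitive : Defs.topologically_transitive (set_val sparse).
Proof.
exists sparse_point => //; apply: subset_closure; exists 0 => //.
by rewrite mulr0 shiftz0.
Qed.

Lemma pow2_lt a b : ((2 ^ a)%N%:Z < (2 ^ b)%N%:Z :> int) -> (2 * 2 ^ a <= 2 ^ b)%N.
Proof. by rewrite ltz_nat ltn_exp2l // => ab; rewrite -expnS leq_exp2l. Qed.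

(* The periodic sequence with zeros exactly at the multiples of [n + 1] has the
   same words of length [n] as the limit points of [sparse_point]. *)
Lemma sparse_not_isolated : ~ isolated_subshift sparse.
Proof.
move=> [n0 aX]; have [n en] : exists n, n = n0.+1 by exists n0.+1.
have [M eM] : exists M, M = n.+1 by exists n.+1.
have eX : sft n (lang (set_val sparse)) = sparse.
  by apply: aX; apply: (@close_le n0 n); [rewrite en|exact: close_sft].
pose y : fullshift := fun i => (i %% M%:Z)%Z != 0.
have Xy : set_val sparse y.
  rewrite -eX => i; apply/sparse_lang.
  (* With this start, the only multiple of [M] that the window can meet is 0, which corresponds to
     the lone zero at [2 ^ M.+1]. *)
  pose o : int := if (i %% M%:Z)%Z == 0 then 0 else (i %% M%:Z)%Z - M%:Z.
  have M0 : M%:Z != 0 by lia.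
  have M1 : 0 < M%:Z by lia.
  have m0 := modz_ge0 i M0; have mM := ltz_pmod i M1.
  exists ((2 ^ M.+1)%N%:Z + o) => k; rewrite size_window => kn; rewrite nth_mkseq //.
  have oM : (`|(o + k%:Z)%R| < M)%N by rewrite /o; case: ifP; lia.
  have MM : (M < 2 ^ M)%N by exact: ltn_expl.
  rewrite -addrA (sparse_point_near MM (ltnW oM)).
  rewrite /y; congr negb; have -> : ((i + k%:Z) %% M%:Z)%Z = ((o + k%:Z) %% M%:Z)%Z.
    rewrite -modzDml /o; case: eqP => [->//|_].
    by rewrite -[RHS]modzDr; congr modz; lia.
  apply/eqP/eqP => [->|h]; first by rewrite mod0z.
  have := divz_eq (o + k%:Z) M%:Z; rewrite h addr0.
  move: ((o + k%:Z) %/ M%:Z)%Z => t et.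
  by have [t0|t0|t0] := ltrgtP t 0; nia.
have /sparse_lang[j r] := lang_window 0 (3 * M).+1 Xy.
have rd (t : nat) : (t < (3 * M).+1)%N -> sparse_point (j + t%:Z) = ((t %% M)%N != 0%N).
  move=> tM; have := r t; rewrite size_window nth_mkseq // => -> //.
  by rewrite /y add0r modz_nat.
have [j0 _] : 0 <= j + 1 /\ forall k, j + 1 <> (2 ^ k)%N%:Z.
  by apply/asboolP; have := rd 1%N; rewrite /sparse_point => -> //; rewrite ?modn_small //; lia.
have pw q : (0 < q <= 3)%N -> exists a, j + (q * M)%N%:Z = (2 ^ a)%N%:Z.
  move=> q3; have qM : (q * M <= 3 * M)%N by rewrite leq_mul2r; lia.
  have Mq : (M <= q * M)%N by rewrite leq_pmull; lia.
  by apply: sparse_pointF; [rewrite rd ?modnMl //; lia|lia].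
(* Three distinct powers of two are never in arithmetic progression. *)
have [a ea] := pw 1%N isT; have [b eb] := pw 2%N isT; have [c ec] := pw 3%N isT.
have ab : (2 * 2 ^ a <= 2 ^ b)%N by apply: pow2_lt; lia.
have bc : (2 * 2 ^ b <= 2 ^ c)%N by apply: pow2_lt; lia.
have : (0 < 2 ^ a)%N by rewrite expn_gt0.
lia.
Qed.

(** The word 1000 would require three consecutive integers to be powers of two, so neighbours avoid
    it and 000 propagates to the left for ever. The resulting fixed point and the letter 1 exclude
    minimality. *)
Lemma sparse_close_not_minimal Y : close 4 sparse Y -> ~ Defs.minimal (set_val Y).
Proof.
move=> XY mY.
have no : ~ lang (set_val Y) [:: true; false; false; false].
  rewrite -XY // => /sparse_lang[i r].
  have := r 0%N isT; rewrite addr0 /= => /asboolP[i0 _].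
  have [|a ea] := sparse_pointF (r 1%N isT); first by lia.
  have [|b eb] := sparse_pointF (r 2%N isT); first by lia.
  have [|c ec] := sparse_pointF (r 3%N isT); first by lia.
  have := @pow2_lt a b; rewrite -ea -eb; have := @pow2_lt b c; rewrite -eb -ec; lia.
have [y Yy ry] : lang (set_val Y) [:: false; false; false].
  rewrite -XY //; apply/sparse_lang; exists (- 3%:Z) => k k3; have {}k3 : (k < 3)%N by [].
  by rewrite sparse_point_neg; [case: k k3 => [|[|[|]]]|lia].
have [y' Yy' ry'] : lang (set_val Y) [:: true].
  rewrite -XY //; apply/sparse_lang; exists 0 => -[|//] _; rewrite addr0 /=.
  apply/asboolP; split=> // k e; have : (0 < 2 ^ k)%N by rewrite expn_gt0.
  lia.
have neg (k : nat) : reads y [:: false; false; false] (- k%:Z).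
  elim: k => [|k IH]; first by rewrite oppr0.
  have h0 := IH 0%N isT; have h1 := IH 1%N isT.
  have e0 : - k.+1%:Z + 1%N%:Z = - k%:Z + 0%N%:Z by lia.
  have e1 : - k.+1%:Z + 2%N%:Z = - k%:Z + 1%N%:Z by lia.
  have e2 : - k.+1%:Z + 3%N%:Z = - k%:Z + 2%N%:Z by lia.
  case e : (y (- k.+1%:Z)).
    exfalso; apply: no; apply: (lang_reads Yy (i := - k.+1%:Z)).
    case=> [|[|[|[|]]]] // _; first by rewrite addr0 e.
    + by rewrite e0 h0.
    + by rewrite e1 h1.
    + by rewrite e2 (IH 2%N isT).
  case=> [|[|[|]]] // _; first by rewrite addr0 e.
  + by rewrite e0 h0.
  + by rewrite e1 h1.
have Y0 : set_val Y (fun=> false).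
  apply: subshift_closure; apply/closure_fullshiftP => N.
  exists (shiftz (- N%:Z) y); first exact: subshift_shiftz.
  move=> i iN; rewrite /shiftz.
  have := neg (absz (N%:Z - i)%R) 0%N isT; rewrite addr0 /= => <-.
  by congr y; lia.
have /closure_fullshiftP/(_ 0%N)[_ [k _ <-] yk] := mY _ Y0 y' Yy'.
by have := ry' 0%N isT; rewrite addr0 yk.
Qed.

(** * Topology of the subspaces *)

Lemma dense_nbhs (T : topologicalType) (G A : set T) (x : T) : dense G -> nbhs x A ->
  exists2 y, G y & A y.
Proof.
move=> dG; rewrite nbhsE => -[W [oW Wx] WA].
have [|y [Wy Gy]] := dG W _ oW; first by exists x.
by exists y => //; exact: WA.
Qed.

Lemma nbhs_set_val (T : topologicalType) (B : set T) (x : B) (A : set T) :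
  nbhs (set_val x) A -> nbhs x (set_val @^-1` A).
Proof. exact: (@initial_continuous _ _ set_val). Qed.

Lemma open_set_val (T : topologicalType) (B : set T) (W : set B) : open W ->
  exists2 A : set T, open A & W = set_val @^-1` A.
Proof. by case=> A oA <-; exists A. Qed.

Lemma not_generic_nbhs (T : topologicalType) (x : T) (A W : set T) :
  nbhs x W -> (forall y, W y -> ~ A y) -> ~ generic A.
Proof.
move=> nW WA [G [dG _ GA]]; have [y Gy Wy] := dense_nbhs dG nW.
exact: WA Wy (GA y Gy).
Qed.

Lemma nbhs_close n X : nbhs X [set Y | close n X Y].
Proof. by apply/nbhs_subshiftP; exists n. Qed.

Definition set_type_of (T : Type) (B : set T) (x : T) (Bx : B x) : set_type B :=
  exist (fun t => t \in B) x (mem_set Bx).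

Definition to_S2' (X : subshift) (nX : ~ isolated_subshift X) : S2' := set_type_of ((isolated_subshiftP X).2 nX).

Lemma S2'_not_isolated (X : S2') : ~ isolated_subshift (set_val X).
Proof. by apply/isolated_subshiftP; exact: set_valP. Qed.

Lemma not_generic_S2' : ~ generic [set X : S2' | minimal_rank1 (set_val X)].
Proof.
apply: (@not_generic_nbhs _ (to_S2' sparse_not_isolated) _ [set X | close 4 sparse (set_val X)]).
  by apply: nbhs_set_val; exact: nbhs_close.
by move=> Y /sparse_close_not_minimal nm [/nm].
Qed.

Lemma not_generic_T2' :
  ~ generic [set X : closure T2' | minimal_rank1 (set_val (set_val X))].
Proof.
have cX : closure T2' (to_S2' sparse_not_isolated).
  by apply: subset_closure; exact: sparse_transitive.
pose x := set_type_of cX.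
apply: (@not_generic_nbhs _ x _ [set X : closure T2' | close 4 sparse (set_val (set_val X))]).
  exact: (nbhs_set_val (nbhs_set_val (nbhs_close 4 (set_val (set_val x))))).
by move=> Y /sparse_close_not_minimal nm [/nm].
Qed.

Definition in_TT2' (X : subshift) :=
  ~ isolated_subshift X /\ Defs.totally_transitive (set_val X).

Lemma close_TT2' (X : subshift) (tX : in_TT2' X) : closure TT2' (to_S2' tX.1).
Proof. by apply: subset_closure; exact: tX.2. Qed.

Lemma closure_TT2'P (X : S2') n : closure TT2' X ->
  exists2 W, in_TT2' W & close n (set_val X) W.
Proof.
move=> cX; have [Z [tZ XZ]] := cX _ (nbhs_set_val (nbhs_close n (set_val X))).
by exists (set_val Z) => //; split; [exact: S2'_not_isolated|exact: tZ].
Qed.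

(** * Limits of sequences of subshifts *)

Section Limit.
Variables (X : nat -> subshift) (n : nat -> nat).
Hypotheses (nS : forall k, (n k < n k.+1)%N) (XS : forall k, close (n k) (X k) (X k.+1)).

Lemma limit_le k l : (k <= l)%N -> (n k <= n l)%N.
Proof.
by move=> /subnKC <-; elim: (l - k)%N => [|m IH]; rewrite ?addn0 // addnS; apply: leq_trans (ltnW (nS _)).
Qed.

Lemma limit_close k l : (k <= l)%N -> close (n k) (X k) (X l).
Proof.
move=> /subnKC <-; elim: (l - k)%N => [|m IH]; first by rewrite addn0.
rewrite addnS; apply: (close_trans IH).
exact: close_le (limit_le (leq_addr m k)) (@XS (k + m)%N).
Qed.

Let P : set fullshift := [set x | forall k, windows_in (n k) (lang (set_val (X k))) x].

Let P_closed : closed P.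
Proof.
move=> x cx k; apply: windows_in_closed; apply: closure_subset cx => y; exact.
Qed.

Let P_shiftz j x : P x -> P (shiftz j x).
Proof. by move=> Px k; exact: windows_in_shiftz. Qed.

(** A word of [X k] of length at most [n k] occurs in all later terms; a cluster point of points
    reading it satisfies every condition that defines [P]. *)
Lemma limit_subshift : exists L, forall k, close (n k) (X k) L.
Proof.
exists (mk_subshift P_closed P_shiftz) => k w wk; split=> [Lw|].
  have xl l : exists2 x, set_val (X (k + l)%N) x & reads x w 0.
    by have := Lw; rewrite (limit_close (leq_addr l k)).
  have [u uP] := choice (fun l => let: ex_intro2 x a b := xl l in ex_intro (fun x => _ /\ _) x (conj a b)).
  have [x xu] := fullshift_cluster u; exists x; last first.
    have [l _ xl'] := xu (size w) 0%N.
    by apply: (@agree_reads (size w) (u l) x) (uP l).2 => [i iN|]; rewrite ?absz0 // xl'.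
  move=> j i; have [l jl xul] := xu (`|i| + n j)%N j.
  have -> : window x i (n j) = window (u l) i (n j).
    by apply/eq_in_map => t; rewrite mem_iota => tn; apply: xul; lia.
  rewrite (@limit_close j (k + l)) ?size_window //; first exact: lang_window (uP l).1.
  by apply: leq_trans jl _; rewrite leq_addl.
move=> /(@lang_extend (mk_subshift P_closed P_shiftz) 0 (n k - size w))[a [b [/size0nil-> bn]]].
move=> [x Px r]; have := Px k 0.
have -> : window x 0 (n k) = w ++ b.
  have wb : size (w ++ b) = n k by rewrite size_cat bn subnKC.
  apply: (@eq_from_nth _ false) => [|t]; rewrite size_window // => tn.
  by rewrite nth_mkseq // r //= wb.
exact: lang_prefix.
Qed.

End Limit.

(** * The Baire argument and its consequences *)

Local Notation K := (closure TT2').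

(** Shrinking neighbourhoods are chosen so that the [k]-th one lies in the [k]-th open set and in
    the subshifts rigid for [k]. The limit is in [G] and rigid for every gap bound, against
    [rank1_rigid_isolated]. *)
Lemma not_generic_TT2' :
  ~ generic [set X : K | minimal_rank1 (set_val (set_val X))].
Proof.
move=> [G [dG [F oF GF] GR]].
have openE k : exists A : set subshift,
    open A /\ F k = [set X : K | A (set_val (set_val X))].
  have [B oB ->] := open_set_val (oF k); have [C oC ->] := open_set_val oB.
  by exists C.
have [A AP] := choice openE.
have step (k : nat) (Xn : subshift * nat) : exists Yn : subshift * nat,
    in_TT2' Xn.1 -> [/\ in_TT2' Yn.1, (Xn.2 < Yn.2)%N,
    close Xn.2 Xn.1 Yn.1 &
    forall Z, close Yn.2 Yn.1 Z -> A k Z /\ gap_rigid k Z].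
  have [tX|] := pselect (in_TT2' Xn.1); last by exists Xn.
  case: Xn tX => X n /= tX.
  pose x : K := set_type_of (@close_TT2' X tX).
  have [Z GZ XZ] : exists2 Z : K, G Z & close n X (set_val (set_val Z)).
    exact: (dense_nbhs dG (nbhs_set_val (nbhs_set_val (nbhs_close n (set_val (set_val x)))))).
  have nbA W : A k W -> exists m, forall W', close m W W' -> A k W'.
    move=> AW; apply/nbhs_subshiftP; apply: open_nbhs_nbhs; split=> //; exact: (AP k).1.
  have [n1 Z1] : exists m, forall W', close m (set_val (set_val Z)) W' -> A k W'.
    apply: nbA; have : F k Z by move: GZ; rewrite GF => /(_ k I).
    by rewrite (AP k).2.
  (* [Z] is only a limit of totally transitive subshifts, so it is first replaced by one, to which
     [approximation] applies. *)
  have [W tW ZW] := closure_TT2'P (maxn n n1) (set_valP Z).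
  have [n2 W2] := nbA W (Z1 _ (close_le (leq_maxr _ _) ZW)).
  have [Y [WY nY ttY _ rY]] := approximation (maxn n n2) k tW.2 tW.1.
  have [n3 Y3] := gap_rigid_open rY.
  exists (Y, (maxn n (maxn n2 n3)).+1) => /= _; split=> //; first by rewrite ltnS leq_maxl.
    exact: close_trans XZ (close_trans (close_le (leq_maxl _ _) ZW) (close_le (leq_maxl _ _) WY)).
  move=> V YV; split.
    apply: W2; apply: (close_trans (close_le (leq_maxr _ _) WY)).
    by apply: (@close_le n2 _ _ _ _ YV); lia.
  by apply: Y3; apply: (@close_le n3 _ _ _ _ YV); lia.
have [st stP] : exists st : nat -> subshift * nat -> subshift * nat, forall k Xn,
    in_TT2' Xn.1 -> [/\ in_TT2' (st k Xn).1, (Xn.2 < (st k Xn).2)%N,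
    close Xn.2 Xn.1 (st k Xn).1 &
    forall Z, close (st k Xn).2 (st k Xn).1 Z -> A k Z /\ gap_rigid k Z].
  have [f fP] := choice (fun p : nat * (subshift * nat) => step p.1 p.2).
  by exists (fun k Xn => f (k, Xn)) => k Xn; exact: (fP (k, Xn)).
have [X0 tX0] := totally_transitive_example.
pose s := fix s k := if k is l.+1 then st l (s l) else (X0, 0%N).
have sP k : in_TT2' (s k).1 by elim: k => [//|k IH]; have [] := stP k _ IH.
have [||L LP] := @limit_subshift (fun k => (s k).1) (fun k => (s k).2).
- by move=> k; have [] := stP k _ (sP k).
- by move=> k; have [] := stP k _ (sP k).
have sk k : (k <= (s k).2)%N.
  by elim: k => [//|k IH]; apply: leq_ltn_trans IH _; have [] := stP k _ (sP k).
have nL : ~ isolated_subshift L.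
  (* An isolated limit would equal a term of the sequence, and no term is isolated. *)
  move=> [m aL]; have e : (s m).1 = L by apply: aL; apply: close_sym; exact: close_le (sk m) (LP m).
  by apply: (sP m).1; exists m; rewrite e.
have AL k : A k L /\ gap_rigid k L by have [_ _ _ h] := stP k _ (sP k); apply: h; exact: (LP k.+1).
have cL : K (to_S2' nL).
  move=> B; case=> C [[D oD <-] DL CB].
  have /nbhs_subshiftP[m mD] : nbhs L D by exact: open_nbhs_nbhs.
  exists (to_S2' (sP m).1); split; first exact: (sP m).2.
  by apply: CB; apply: mD; apply: close_sym; exact: close_le (sk m) (LP m).
have /GR[mL [V rV cV]] : G (set_type_of cL).
  by rewrite GF => k _; rewrite (AP k).2; exact: (AL k).1.
by apply: (nL); apply: (rank1_rigid_isolated mL cV rV) => C; exact: (AL C).2.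
Qed.

Lemma dense_minimal_rank1 : dense [set X : K | minimal_rank1 (set_val (set_val X))].
Proof.
move=> W [X WX] oW; have [B oB eB] := open_set_val oW; have [A oA eA] := open_set_val oB.
have [n nA] : exists n, forall Y, close n (set_val (set_val X)) Y -> A Y.
  apply/nbhs_subshiftP; apply: open_nbhs_nbhs; split=> //.
  by move: WX; rewrite eB eA.
have [Z tZ XZ] := closure_TT2'P n (set_valP X).
have [Y [ZY nY ttY rY _]] := approximation n 0 tZ.2 tZ.1.
exists (set_type_of (@close_TT2' Y (conj nY ttY))); split=> //.
by rewrite eB eA; apply: nA; exact: close_trans XZ ZY.
Qed.

(** The set is dense, so as a G-delta set it would be generic. *)
Lemma not_Gdelta_TT2' :
  ~ Gdelta [set X : K | minimal_rank1 (set_val (set_val X))].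
Proof.
move=> Gd; apply: not_generic_TT2'.
by eexists; split; [exact: dense_minimal_rank1|exact: Gd|].
Qed.

(** [K] is contained in the closure of [T2'], and the trace on [K] of a G-delta set is a G-delta
    set. *)
Lemma not_Gdelta_T2' :
  ~ Gdelta [set X : closure T2' | minimal_rank1 (set_val (set_val X))].
Proof.
move=> [F oF FE]; apply: not_Gdelta_TT2'.
have sub X : K X -> closure T2' X.
  by apply: closure_subset => Y tY; exact: tY.
have openE k : exists B : set S2', open B /\ F k = set_val @^-1` B.
  by have [B oB ->] := open_set_val (oF k); exists B.
have [B BP] := choice openE.
exists (fun k => (set_val : K -> S2') @^-1` B k) => [k|].
  by exists (B k) => //; exact: (BP k).1.
apply/seteqP; split=> X.
  move=> rX k _; have : (\bigcap_k F k) (set_type_of (sub _ (set_valP X))) by rewrite -FE.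
  by move=> /(_ k I); rewrite (BP k).2.
move=> BX; have : [set X : closure T2' | minimal_rank1 (set_val (set_val X))]
    (set_type_of (sub _ (set_valP X))).
  by rewrite FE => k _; rewrite (BP k).2; exact: BX.
by [].
Qed.

Theorem theorem7p4 :
  [/\ ~ generic [set X : S2' | minimal_rank1 (set_val X)],
      ~ generic [set X : closure T2' | minimal_rank1 (set_val (set_val X))] &
      ~ generic [set X : closure TT2' | minimal_rank1 (set_val (set_val X))]] /\
  ~ Gdelta [set X : closure T2' | minimal_rank1 (set_val (set_val X))] /\
  ~ Gdelta [set X : closure TT2' | minimal_rank1 (set_val (set_val X))].
Proof.
split; last by split; [exact: not_Gdelta_T2'|exact: not_Gdelta_TT2'].
by split; [exact: not_generic_S2'|exact: not_generic_T2'|exact: not_generic_TT2'].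
Qed.
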